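(* Suppose $J_1>J_2>0$. For each $\delta>0$ there exist constants $c=c(\delta)>0$ and $\beta_0=\beta_0(\delta)<\infty$ (possibly depending on the couplings) such that for each $\beta\ge\beta_0$ and $\mathcal S\ge c\beta^2$, if the even integer $N$ is sufficiently large then for all $\boldsymbol r,\boldsymbol r'\in\mathbb T_N$: $$\mathcal S^{-4}\bigl\langle[\hat S^x_{\boldsymbol r}]^2[\hat S^x_{\boldsymbol r'}]^2\bigr\rangle_{N,\beta}\ge1-2\delta,\qquad \mathcal S^{-4}\bigl\langle[\hat S^\alpha_{\boldsymbol r}]^2[\hat S^\alpha_{\boldsymbol r'}]^2\bigr\rangle_{N,\beta}<\delta,\ \ \alpha=y,z.$$ The analogous statement holds for $J_2>J_1>0$ with the indices $x$ and $z$ interchanged.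
   Context: Let $\mathcal S\in\{\frac12,1,\frac32,\dots\}$. On each site $\boldsymbol r$ of the torus $\mathbb T_N=(\mathbb Z/N\mathbb Z)^2$ ($N$ even) put a copy of $\mathbb C^{2\mathcal S+1}$ with basis $|M\rangle$, $M=-\mathcal S,\dots,\mathcal S$; the Hilbert space is the tensor product. Single-site operators: $\hat S^z|M\rangle=M|M\rangle$, $\hat S^{\pm}|M\rangle=\sqrt{\mathcal S(\mathcal S+1)-M(M\pm1)}\,|M\pm1\rangle$, $\hat S^x=\frac12(\hat S^++\hat S^-)$, $\hat S^y=\frac1{2i}(\hat S^+-\hat S^-)$; $\hat S^\alpha_{\boldsymbol r}$ acts at site $\boldsymbol r$. Edge types: $\langle \boldsymbol r,\boldsymbol r+\boldsymbol e_1\rangle$ is an $x$-edge if $r_1$ is even and a $z$-edge otherwise; $\langle\boldsymbol r,\boldsymbol r+\boldsymbol e_2\rangle$ is an $x$-edge if $r_2$ is even and a $z$-edge otherwise. $\hat{\mathcal H}_N=-J_1\mathcal S^{-2}\sum_{x\text{-edges}}\hat S^x_{\boldsymbol r}\hat S^x_{\boldsymbol r'}-J_2\mathcal S^{-2}\sum_{z\text{-edges}}\hat S^z_{\boldsymbol r}\hat S^z_{\boldsymbol r'}$, and $\langle\hat A\rangle_{N,\beta}=\mathrm{Tr}(\hat A e^{-\beta\hat{\mathcal H}_N})/\mathrm{Tr}(e^{-\beta\hat{\mathcal H}_N})$. *)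

(* Defs.v *)
From HB Require Import structures.
From mathcomp Require Import all_boot all_order all_algebra.
From mathcomp Require Import complex.
From mathcomp Require Import all_classical all_reals all_analysis.

Set Implicit Arguments.
Unset Strict Implicit.
Unset Printing Implicit Defensive.

Import Order.TTheory GRing.Theory Num.Theory numFieldNormedType.Exports.
Local Open Scope ring_scope.

Section Model.
Variable R : realType.
Local Notation C := R[i].

Definition climn (u : nat -> C) : C :=
  Complex (limn (fun n => complex.Re (u n))) (limn (fun n => complex.Im (u n))).

Definition expmx (n : nat) (A : 'M[C]_n) : 'M[C]_n :=
  \matrix_(i, j) climn (fun m => (\sum_(k < m) (k`!%:R)^-1 *: A ^+ k) i j).

(* basis index m : 'I_(twoS.+1) corresponds to M = m - S; entries A i j = <i|A|j> *)
Definition spinS (twoS : nat) : R := twoS%:R / 2.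
Definition magM (twoS : nat) (m : 'I_twoS.+1) : R := m%:R - spinS twoS.

Definition Splus1 (twoS : nat) : 'M[C]_(twoS.+1) :=
  \matrix_(i, j)
    (if i == j.+1 :> nat then
       (Num.sqrt (spinS twoS * (spinS twoS + 1) - magM j * (magM j + 1)))%:C%C
     else 0).
Definition Sminus1 (twoS : nat) : 'M[C]_(twoS.+1) :=
  \matrix_(i, j)
    (if i.+1 == j :> nat then
       (Num.sqrt (spinS twoS * (spinS twoS + 1) - magM j * (magM j - 1)))%:C%C
     else 0).
Definition Sx1 (twoS : nat) : 'M[C]_(twoS.+1) := 2^-1 *: (Splus1 twoS + Sminus1 twoS).
Definition Sy1 (twoS : nat) : 'M[C]_(twoS.+1) :=
  (2 * 'i%C)^-1 *: (Splus1 twoS - Sminus1 twoS).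
Definition Sz1 (twoS : nat) : 'M[C]_(twoS.+1) := \matrix_(i, j) (if i == j then (magM i)%:C%C else 0).

Inductive axis := ax_x | ax_y | ax_z.
Definition S1 (twoS : nat) (a : axis) : 'M[C]_(twoS.+1) :=
  match a with ax_x => Sx1 twoS | ax_y => Sy1 twoS | ax_z => Sz1 twoS end.

Definition site (N : nat) := ('I_N * 'I_N)%type.
(* basis of the tensor product: one local basis state per site *)
Definition config (N twoS : nat) := {ffun site N -> 'I_twoS.+1}.
Definition dimH (N twoS : nat) := #|{: config N twoS}|.
Definition Op (N twoS : nat) := 'M[C]_(dimH N twoS).

Definition op_of_kernel (N twoS : nat) (K : config N twoS -> config N twoS -> C)
  : Op N twoS :=
  \matrix_(i, j) K (enum_val i) (enum_val j).

Definition at_site (N twoS : nat) (A : 'M[C]_(twoS.+1)) (r : site N) : Op N twoS :=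
  op_of_kernel (fun s t => A (s r) (t r) *
     (if [forall q : site N, (q != r) ==> (s q == t q)] then 1 else 0)).

Definition Sop (N twoS : nat) (a : axis) (r : site N) : Op N twoS :=
  at_site (S1 twoS a) r.

Definition hbond (N : nat) (r r' : site N) : bool :=
  (r'.1 == (r.1.+1 %% N)%N :> nat) && (r'.2 == r.2).
Definition vbond (N : nat) (r r' : site N) : bool :=
  (r'.2 == (r.2.+1 %% N)%N :> nat) && (r'.1 == r.1).
Definition xedge (N : nat) (r r' : site N) : bool :=
  (hbond r r' && ~~ odd r.1) || (vbond r r' && ~~ odd r.2).
Definition zedge (N : nat) (r r' : site N) : bool :=
  (hbond r r' && odd r.1) || (vbond r r' && odd r.2).

Definition Ham (J1 J2 : R) (N twoS : nat) : Op N twoS :=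
  - ((J1 / spinS twoS ^+ 2)%:C%C *:
       \sum_(r : site N) \sum_(r' : site N | xedge r r') (Sop twoS ax_x r *m Sop twoS ax_x r'))
  - ((J2 / spinS twoS ^+ 2)%:C%C *:
       \sum_(r : site N) \sum_(r' : site N | zedge r r') (Sop twoS ax_z r *m Sop twoS ax_z r')).

Definition gibbs (J1 J2 beta : R) (N twoS : nat) (A : Op N twoS) : C :=
  let E := expmx (- (beta%:C%C) *: Ham J1 J2 N twoS) in
  \tr (A *m E) / \tr E.

Definition corr4 (J1 J2 beta : R) (N twoS : nat) (a : axis) (r r' : site N) : C :=
  ((spinS twoS ^- 4)%:C%C) *
  gibbs J1 J2 beta
    ((Sop twoS a r *m Sop twoS a r) *m (Sop twoS a r' *m Sop twoS a r')).

(* The conclusion of Theorem 2.6 with [a] the ordered axis and [b], [b'] the other two. *)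
Definition ordered_claim (J1 J2 : R) (a b b' : axis) : Prop :=
  forall delta : R, 0 < delta ->
  exists c : R, 0 < c /\ exists beta0 : R,
  forall beta : R, beta0 <= beta ->
  forall twoS : nat, (0 < twoS)%N -> c * beta ^+ 2 <= spinS twoS ->
  exists N0 : nat, forall N : nat, (N0 <= N)%N -> ~~ odd N ->
  forall r r' : site N,
    ((1 - 2 * delta)%:C%C <= corr4 J1 J2 beta twoS a r r') /\
    (corr4 J1 J2 beta twoS b r r' < delta%:C%C) /\
    (corr4 J1 J2 beta twoS b' r r' < delta%:C%C).

End Model.

(* Main.v *)
Require Import Defs.
From HB Require Import structures.
From mathcomp Require Import all_boot all_order all_algebra.
From mathcomp Require Import complex.
From mathcomp Require Import all_classical all_reals all_analysis.
From mathcomp Require Import ring lra.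

(** Let [a] be the axis with the larger coupling [Ja], [b] the one with the smaller coupling
[Jb] and [c] the [y] axis. Every site lies on two [a]-edges and two [b]-edges, so
[2 X X' <= X^2 + X'^2] and the Casimir identity give the operator inequality
[H >= - Ja (1 + 1/S) N^2 + sum_r ((Ja - Jb) (S^b_r)^2 + Ja (S^c_r)^2) / S^2].
Conversely, convexity of [log Z] bounds [- beta <H>] from below by [log (Z / dim)], and the
Peierls inequality bounds [Z] from below by the product eigenstates of [S^a] whose levels all
exceed [(1 - eta) S]: their energies are at most [- Ja (1 - eta)^2 N^2], since [S^b] has zero
diagonal in that basis, and they are a fraction at least [(eta / 4) ^ (N^2)] of the basis.
Comparing the two bounds, the site average of [<(S^b_r)^2 + (S^c_r)^2> / S^2] is small uniformly
in [N], and since the symmetries of the lattice act transitively on the sites, so is each term.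
The correlations then follow from the positivity of [(K - A_r) (K - A_r')] and of
[A_r (K - A_r')], where [A = (S^d)^2] for an axis [d] and [K = S (S + 1)]. *)

Set Implicit Arguments.
Unset Strict Implicit.
Unset Printing Implicit Defensive.

Import Order.TTheory GRing.Theory Num.Theory numFieldNormedType.Exports.
Local Open Scope classical_set_scope.
Local Open Scope ring_scope.
Local Open Scope sesquilinear_scope.

(** * Matrix exponentials, Gibbs states and bounds on the partition function *)

Section GibbsStates.
Variable R : realType.
Local Notation C := R[i].

Lemma ReD (x y : C) : complex.Re (x + y) = complex.Re x + complex.Re y.
Proof. by case: x y => [? ?] [? ?]. Qed.

Lemma ImD (x y : C) : complex.Im (x + y) = complex.Im x + complex.Im y.
Proof. by case: x y => [? ?] [? ?]. Qed.

Lemma Re_sum (I : Type) (r : seq I) (P : pred I) (F : I -> C) :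
  complex.Re (\sum_(i <- r | P i) F i) = \sum_(i <- r | P i) complex.Re (F i).
Proof. exact: (big_morph _ ReD). Qed.

Lemma Im_sum (I : Type) (r : seq I) (P : pred I) (F : I -> C) :
  complex.Im (\sum_(i <- r | P i) F i) = \sum_(i <- r | P i) complex.Im (F i).
Proof. exact: (big_morph _ ImD). Qed.

Lemma ReM_real (a : R) (x : C) : complex.Re (a%:C%C * x) = a * complex.Re x.
Proof. by case: x => u v /=; rewrite mul0r subr0. Qed.

Lemma ImM_real (a : R) (x : C) : complex.Im (a%:C%C * x) = a * complex.Im x.
Proof. by case: x => u v /=; rewrite mul0r addr0. Qed.

Lemma adjM m n p (A : 'M[C]_(m, n)) (B : 'M[C]_(n, p)) :
  (A *m B)^t* = B^t* *m A^t*.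
Proof. by rewrite trmx_mul map_mxM. Qed.

Lemma unitary_adjl n (U : 'M[C]_n) : U \is unitarymx -> U^t* *m U = 1%:M.
Proof. by rewrite -trmxC_unitary => /unitarymxP; rewrite trmxCK. Qed.

Definition rdiag n (d : 'I_n -> R) : 'M[C]_n := diag_mx (\row_i (d i)%:C%C).

Lemma conj_rdiagE n (U : 'M[C]_n) (d : 'I_n -> R) i j :
  (U^t* *m rdiag d *m U) i j = \sum_l (d l)%:C%C * ((U l i)^* * U l j).
Proof.
rewrite /rdiag mul_mx_diag mxE; apply: eq_bigr => l _.
by rewrite !mxE mulrAC mulrC.
Qed.

Lemma conj_rdiag_exp n (U : 'M[C]_n) (d : 'I_n -> R) k : U \is unitarymx ->
  (U^t* *m rdiag d *m U) ^+ k = U^t* *m rdiag (fun i => d i ^+ k) *m U.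
Proof.
move=> Uu; elim: k => [|k IHk].
  rewrite expr0 /rdiag (_ : diag_mx _ = 1%:M) ?mulmx1 ?unitary_adjl //.
  by apply/matrixP => i j; rewrite !mxE expr0.
rewrite exprS IHk.
rewrite -!mulmxE !mulmxA (mulmxtVK _ Uu) -(mulmxA (U^t*)) mulmx_diag.
congr (_ *m diag_mx _ *m _); apply/rowP => i.
by rewrite !mxE exprS rmorphM.
Qed.

Lemma cvg_sumn (n : nat) (F : 'I_n -> nat -> R) (l : 'I_n -> R) :
  (forall i, F i m @[m --> \oo] --> l i) ->
  (\sum_i F i m) @[m --> \oo] --> \sum_i l i.
Proof. by move=> Fl; apply: cvg_big => [|i _]; [exact: add_continuous|exact: Fl]. Qed.

(** Every partial sum of the series is conjugate, by the same [U], to a diagonal matrix of partial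
    sums of real exponential series. Each entry is then a finite combination of convergent real
    series, for the real and the imaginary part separately. *)
Lemma expmx_conj_rdiag n (U : 'M[C]_n) (d : 'I_n -> R) : U \is unitarymx ->
  expmx (U^t* *m rdiag d *m U) = U^t* *m rdiag (fun i => expR (d i)) *m U.
Proof.
move=> Uu; apply/matrixP => i j; rewrite mxE conj_rdiagE.
have partE m : (\sum_(k < m) (k`!%:R)^-1 *: (U^t* *m rdiag d *m U) ^+ k) i j
    = \sum_l (series (exp_coeff (d l)) m)%:C%C * ((U l i)^* * U l j).
  rewrite summxE.
  under eq_bigr => k _ do rewrite mxE conj_rdiag_exp // conj_rdiagE mulr_sumr.
  rewrite exchange_big /=; apply: eq_bigr => l _.
  rewrite /series /= big_mkord rmorph_sum mulr_suml; apply: eq_bigr => k _.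
  rewrite mulrA; congr (_ * _).
  by rewrite -[exp_coeff _ _]/(d l ^+ k / k`!%:R) mulrC rmorphM fmorphV rmorph_nat.
have cvge l (c : R) :
    (series (exp_coeff (d l)) m * c) @[m --> \oo] --> expR (d l) * c.
  apply: cvgMr_tmp; exact: is_cvg_series_exp_coeff.
rewrite /climn; apply/eqP; rewrite eq_complex /= Re_sum Im_sum.
apply/andP; split; apply/eqP/cvg_lim => //.
  under eq_fun => m.
    rewrite partE Re_sum; under eq_bigr => l _ do rewrite ReM_real; over.
  by under eq_bigr => l _ do rewrite ReM_real; exact: cvg_sumn.
under eq_fun => m.
  rewrite partE Im_sum; under eq_bigr => l _ do rewrite ImM_real; over.
by under eq_bigr => l _ do rewrite ImM_real; exact: cvg_sumn.
Qed.

Lemma hermitian_spectral n (B : 'M[C]_n) : B^t* = B ->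
  exists U : 'M[C]_n, exists d : 'I_n -> R,
    U \is unitarymx /\ B = U^t* *m rdiag d *m U.
Proof.
move=> Bh; have Bherm : B \is hermsymmx.
  by apply/is_hermitianmxP; rewrite expr0 scale1r Bh.
have /orthomx_spectralP BE := hermitian_normalmx Bherm.
exists (spectralmx B), (fun i => complex.Re (spectral_diag B 0 i)).
have Uu := spectral_unitarymx B; split=> //.
rewrite {1}BE (invmx_unitary Uu); congr (_ *m diag_mx _ *m _).
apply/rowP => i; rewrite mxE.
by have /mxOverP/(_ 0 i)/RRe_real -> := hermitian_spectral_diag_real Bherm.
Qed.

Lemma expmx_unitary_conj n (V B : 'M[C]_n) : V \is unitarymx -> B^t* = B ->
  expmx (V *m B *m V^t*) = V *m expmx B *m V^t*.
Proof.
move=> Vu /hermitian_spectral[U [d [Uu ->]]].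
have UVu : U *m V^t* \is unitarymx.
  by apply: mul_unitarymx; rewrite ?trmxC_unitary.
have conjE D : V *m (U^t* *m D *m U) *m V^t*
    = (U *m V^t*)^t* *m D *m (U *m V^t*).
  by rewrite adjM trmxCK !mulmxA.
by rewrite conjE !expmx_conj_rdiag // conjE.
Qed.

(** [B] plays the role of [- beta H]: temperature and couplings enter only through one Hermitian
    matrix. *)
Definition gstate n (B A : 'M[C]_n) : C := \tr (A *m expmx B) / \tr (expmx B).

(** In particular, a unitary that commutes with [B] leaves the state invariant, which is how lattice
    symmetries will act. *)
Lemma gstate_unitary_conj n (V B A : 'M[C]_n) : V \is unitarymx -> B^t* = B ->
  gstate (V *m B *m V^t*) (V *m A *m V^t*) = gstate B A.
Proof.
move=> Vu Bh; rewrite /gstate expmx_unitary_conj //.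
have trE X : \tr (V *m X *m V^t*) = \tr X.
  by rewrite mxtrace_mulC mulmxA unitary_adjl // mul1mx.
by rewrite trE -(trE (A *m _)) !mulmxA mulmxKtV.
Qed.

Lemma gstateD n (B A A' : 'M[C]_n) : gstate B (A + A') = gstate B A + gstate B A'.
Proof. by rewrite /gstate mulmxDl mxtraceD mulrDl. Qed.

Lemma gstateZ n (B A : 'M[C]_n) a : gstate B (a *: A) = a * gstate B A.
Proof. by rewrite /gstate -scalemxAl mxtraceZ mulrA. Qed.

Lemma gstateN n (B A : 'M[C]_n) : gstate B (- A) = - gstate B A.
Proof. by rewrite -scaleN1r gstateZ mulN1r. Qed.

Lemma gstate_sum n (B : 'M[C]_n) (I : Type) (r : seq I) (P : pred I) (F : I -> 'M[C]_n) :
  gstate B (\sum_(i <- r | P i) F i) = \sum_(i <- r | P i) gstate B (F i).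
Proof.
by apply: big_morph => [? ?|]; rewrite ?gstateD // /gstate mul0mx mxtrace0 mul0r.
Qed.

Lemma tr_mul_expmx n (U A : 'M[C]_n) (d : 'I_n -> R) : U \is unitarymx ->
  \tr (A *m expmx (U^t* *m rdiag d *m U))
  = \sum_i (expR (d i))%:C%C * (U *m A *m U^t*) i i.
Proof.
move=> Uu; rewrite expmx_conj_rdiag // !mulmxA mxtrace_mulC !mulmxA.
by rewrite /rdiag mul_mx_diag; apply: eq_bigr => i _; rewrite !mxE mulrC.
Qed.

Lemma tr_expmx n (U : 'M[C]_n) (d : 'I_n -> R) : U \is unitarymx ->
  \tr (expmx (U^t* *m rdiag d *m U)) = (\sum_i expR (d i))%:C%C.
Proof.
move=> Uu; rewrite -[expmx _]mul1mx tr_mul_expmx // mulmx1 (unitarymxP _) //.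
by rewrite rmorph_sum; apply: eq_bigr => i _; rewrite mxE eqxx mulr1.
Qed.

Lemma sum_expR_gt0 n (d : 'I_n -> R) : (0 < n)%N -> 0 < \sum_i expR (d i).
Proof.
move=> n0; rewrite lt_neqAle sumr_ge0 ?andbT; last by move=> i _; exact: expR_ge0.
rewrite eq_sym psumr_neq0; last by move=> i _; exact: expR_ge0.
by apply/hasP; exists (Ordinal n0); rewrite ?mem_index_enum //= expR_gt0.
Qed.

Lemma gstate1 n (B : 'M[C]_n) : (0 < n)%N -> B^t* = B -> gstate B 1%:M = 1.
Proof.
move=> n0 /hermitian_spectral[U [d [Uu ->]]]; rewrite /gstate mul1mx divff //.
rewrite tr_expmx // -(rmorph0 (real_complex R)) (inj_eq (@complexI R)).
by rewrite gt_eqF // sum_expR_gt0.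
Qed.

(** In an eigenbasis of [B] the numerator is a combination, with weights [expR (d i)], of diagonal
    entries of a conjugate of [A^t* *m A]; these entries are sums of squared moduli. *)
Lemma gstate_ge0 n (B A : 'M[C]_n) : B^t* = B -> 0 <= gstate B (A^t* *m A).
Proof.
move=> /hermitian_spectral[U [d [Uu ->]]]; rewrite /gstate tr_expmx // tr_mul_expmx //.
apply: divr_ge0; last by rewrite ler0c sumr_ge0 // => i _; exact: expR_ge0.
apply: sumr_ge0 => i _; apply: mulr_ge0; first by rewrite ler0c expR_ge0.
rewrite mulmxA -mulmxA -{1}(trmxCK U) -adjM.
set W := A *m _; rewrite mxE; apply: sumr_ge0 => l _.
by rewrite !mxE mulrC mul_conjC_ge0.
Qed.

(* Compare [expR] with its tangent at the mean. *)
Lemma jensen_expR (I : finType) (p x : I -> R) :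
  (forall i, 0 <= p i) -> \sum_i p i = 1 ->
  expR (\sum_i p i * x i) <= \sum_i p i * expR (x i).
Proof.
move=> p0 p1; set m := \sum_i p i * x i.
have -> : expR m = \sum_i p i * (expR m * (1 + (x i - m))).
  have termE i : p i * (expR m * (1 + (x i - m))) = expR m * (p i + (p i * x i - p i * m)).
    by ring.
  under eq_bigr => i _ do rewrite termE.
  by rewrite -mulr_sumr big_split sumrB /= -mulr_suml p1 -/m mul1r subrr addr0 mulr1.
apply: ler_sum => i _; apply: ler_wpM2l => //.
rewrite -[leRHS](_ : expR m * expR (x i - m) = _); last first.
  by rewrite -expRD addrC subrK.
by rewrite ler_wpM2l ?expR_ge0 ?expR_ge1Dx.
Qed.

(* Convexity of [log Z]: the entropy of the Gibbs state is at most [log n]. *)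
Lemma partition_le_energy n (B : 'M[C]_n) : (0 < n)%N -> B^t* = B ->
  complex.Re (\tr (expmx B)) <= n%:R * expR (complex.Re (gstate B B)).
Proof.
move=> n0 /hermitian_spectral[U [d [Uu ->]]]; rewrite /gstate.
rewrite tr_expmx // tr_mul_expmx //; set Z := \sum_i expR (d i).
have Z0 : 0 < Z by exact: sum_expR_gt0.
have diagE i : (U *m (U^t* *m rdiag d *m U) *m U^t*) i i = (d i)%:C%C.
  rewrite !mulmxA mulmxtVK // (unitarymxP _) // mul1mx.
  by rewrite !mxE eqxx mulr1n.
rewrite [X in expR (complex.Re X)](_ : _ = (\sum_i (expR (d i) / Z) * d i)%:C%C); last first.
  rewrite [RHS]rmorph_sum [LHS]mulr_suml; apply: eq_bigr => i _.
  by rewrite diagE !rmorphM fmorphV /= mulrAC.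
rewrite /=; have p1 : \sum_i expR (d i) / Z = 1 by rewrite -mulr_suml divff // gt_eqF.
(* Under the Gibbs weights [expR (d i) / Z], the mean of [expR (- d i)] is exactly [n / Z]. *)
have := jensen_expR (fun i => - d i)
  (fun i => divr_ge0 (expR_ge0 (d i)) (ltW Z0)) p1.
rewrite [X in _ <= X -> _](eq_bigr (fun=> Z^-1)); last first.
  by move=> i _; rewrite mulrAC expRN divff ?gt_eqF ?expR_gt0 // mul1r.
rewrite sumr_const card_ord.
rewrite [X in expR X <= _](eq_bigr (fun i => - (expR (d i) / Z * d i))); last first.
  by move=> i _; rewrite mulrN.
rewrite sumrN expRN => le1.
rewrite -ler_pdivrMr ?expR_gt0 // (le_trans (_ : _ <= Z * (Z^-1 *+ n))) //.
  by rewrite ler_pM2l.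
by rewrite -[Z^-1 *+ n]mulr_natl mulrCA divff ?gt_eqF // mulr1.
Qed.

(** Spectral weights turn the diagonal entry of [expmx B] at each vector of the basis [V] into an
    average of [expR], so Jensen bounds it below by the exponential of the diagonal entry of [B].
    The vectors outside [P] contribute nonnegative terms and are dropped. *)
Lemma peierls n (B V : 'M[C]_n) (P : pred 'I_n) (e : R) :
  B^t* = B -> V \is unitarymx ->
  (forall k, P k -> e <= complex.Re ((V *m B *m V^t*) k k)) ->
  #|P|%:R * expR e <= complex.Re (\tr (expmx B)).
Proof.
move=> /hermitian_spectral[U [d [Uu ->]]] Vu leP.
pose W := U *m V^t*.
have Wu : W \is unitarymx by apply: mul_unitarymx; rewrite ?trmxC_unitary.
(* [p k l] is the squared overlap of the [k]-th vector of [V] with the [l]-th eigenvector of [B]. As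
   [W] is unitary, [p] is doubly stochastic: rows serve for Jensen, columns for the trace. *)
pose p k l : R := complex.Re ((W l k)^* * W l k).
have pE k l : (W l k)^* * W l k = (p k l)%:C%C.
  by rewrite RRe_real // ger0_real // mulrC mul_conjC_ge0.
have p0 k l : 0 <= p k l by rewrite -ler0c -pE mulrC mul_conjC_ge0.
have WB k (f : 'I_n -> R) :
    (V *m (U^t* *m rdiag f *m U) *m V^t*) k k = (\sum_l p k l * f l)%:C%C.
  rewrite (_ : V *m _ *m _ = W^t* *m rdiag f *m W); last first.
    by rewrite /W adjM trmxCK !mulmxA.
  rewrite conj_rdiagE rmorph_sum; apply: eq_bigr => l _.
  by rewrite pE mulrC rmorphM.
have p1 k : \sum_l p k l = 1.
  apply: (@complexI R); rewrite rmorph_sum [RHS]rmorph1.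
  rewrite (eq_bigr (fun l => (W l k)^* * W l k)); last by move=> l _; rewrite pE.
  have /matrixP/(_ k k) := unitary_adjl Wu; rewrite !mxE eqxx mulr1n => <-.
  by apply: eq_bigr => l _; rewrite !mxE.
have -> : complex.Re (\tr (expmx (U^t* *m rdiag d *m U)))
    = \sum_k \sum_l p k l * expR (d l).
  rewrite exchange_big /= tr_expmx //=; apply: eq_bigr => l _.
  rewrite -mulr_suml (_ : \sum_i _ = 1) ?mul1r //.
  apply: (@complexI R); rewrite rmorph_sum [RHS]rmorph1.
  rewrite (eq_bigr (fun k => W l k * (W l k)^*)); last by move=> k _; rewrite mulrC pE.
  have /unitarymxP/matrixP/(_ l l) := Wu; rewrite !mxE eqxx mulr1n => <-.
  by apply: eq_bigr => k _; rewrite !mxE.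
rewrite mulr_natl -sumr_const.
rewrite (le_trans (_ : _ <= \sum_(k in P) \sum_l p k l * expR (d l))) //; last first.
  rewrite [leRHS](bigID (mem P)) /= lerDl.
  by apply: sumr_ge0 => k _; apply: sumr_ge0 => l _; rewrite mulr_ge0 ?expR_ge0.
apply: ler_sum => k Pk; apply: le_trans (jensen_expR _ (p0 k) (p1 k)).
by rewrite ler_expR; have := leP k Pk; rewrite WB.
Qed.

End GibbsStates.

(** * Ladder operators, the Casimir identity and the commutation relation *)

Section SpinAlgebra.
Variables (R : realType) (n : nat).
Local Notation C := R[i].

(** With [M = j - n/2] and [S = n/2], this is the square root of [S (S + 1) - M (M + 1)], factored
    so that its vanishing at [j = n] is visible. *)
Definition ladder (j : nat) : R := Num.sqrt ((n%:R - j%:R) * (j%:R + 1)).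

Lemma Splus1E : Splus1 R n = \matrix_(i, j) (if i == j.+1 :> nat then (ladder j)%:C%C else 0).
Proof.
apply/matrixP => i j; rewrite !mxE; case: eqP => // _; congr (Num.sqrt _)%:C%C.
by rewrite /magM /spinS; field.
Qed.

Lemma Sminus1E : Sminus1 R n = \matrix_(i, j) (if j == i.+1 :> nat then (ladder i)%:C%C else 0).
Proof.
apply/matrixP => i j; rewrite !mxE eq_sym; case: eqP => // ji; congr (Num.sqrt _)%:C%C.
by rewrite /magM /spinS ji -natr1; field.
Qed.

Lemma adj_Splus1 : (Splus1 R n)^t* = Sminus1 R n.
Proof.
rewrite Splus1E Sminus1E; apply/matrixP => i j; rewrite !mxE.
by case: eqP => _; [exact: conjc_real|exact: conjC0].
Qed.

Lemma adj_Sminus1 : (Sminus1 R n)^t* = Splus1 R n.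
Proof. by rewrite -adj_Splus1 trmxCK. Qed.

Lemma sum_ord_if_eq (f : nat -> C) (m : nat) :
  \sum_(j < n.+1) (if j == m :> nat then f j else 0) = if (m < n.+1)%N then f m else 0.
Proof. by rewrite -big_mkcond big_ord1_eq. Qed.

Lemma sqr_ladder j : (j <= n)%N -> ladder j * ladder j = (n%:R - j%:R) * (j%:R + 1).
Proof.
move=> jn; rewrite -expr2 sqr_sqrtr // mulr_ge0 ?subr_ge0 ?ler_nat //.
Qed.

Lemma Splus_Sminus :
  Splus1 R n *m Sminus1 R n = rdiag (fun i : 'I_n.+1 => (n%:R - i%:R + 1) * i%:R).
Proof.
rewrite Splus1E Sminus1E; apply/matrixP => i k; rewrite !mxE.
(* At the lowest level the row of [Splus1] is zero, in agreement with the factor [i]. *)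
case: i => [[|i] ilt] /=.
  rewrite mulr0 mul0rn big1 // => j _.
  by rewrite !mxE /= mul0r.
under eq_bigr => j _.
  rewrite !mxE eqSS eq_sym.
  rewrite (_ : _ * _ = if j == i :> nat then
    (if k == i.+1 :> nat then (ladder i * ladder i)%:C%C else 0) else 0); last first.
    by case: eqP => [->|_]; rewrite ?mul0r //; case: eqP => _; rewrite ?mulr0 // rmorphM.
  over.
rewrite (sum_ord_if_eq (fun=> _)) ltnW // sqr_ladder; last exact: ltnW.
rewrite -val_eqE /= eq_sym; case: eqP => _; rewrite ?mulr1n ?mulr0n //.
by rewrite -natr1; congr (_ * _)%:C%C; ring.
Qed.

Lemma Sminus_Splus :
  Sminus1 R n *m Splus1 R n = rdiag (fun i : 'I_n.+1 => (n%:R - i%:R) * (i%:R + 1)).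
Proof.
rewrite Splus1E Sminus1E; apply/matrixP => i k; rewrite !mxE.
under eq_bigr => j _.
  rewrite !mxE.
  rewrite (_ : _ * _ = if j == i.+1 :> nat then
    (if k == i then (ladder i * ladder i)%:C%C else 0) else 0); last first.
    case: eqP => [->|_]; rewrite ?mul0r // eqSS [k == i]eq_sym -val_eqE /=.
    by case: eqP => [->|_]; rewrite ?mulr0 // rmorphM.
  over.
rewrite (sum_ord_if_eq (fun=> _)) ltnS sqr_ladder; last by rewrite -ltnS.
rewrite eq_sym; case: eqP => [->|_]; rewrite ?mulr1n ?mulr0n ?if_same //.
(* At the top level there is nothing to raise to, in agreement with the factor [n - k]. *)
case: ltnP => // nk; have -> : (k : nat) = n by apply/eqP; rewrite eqn_leq nk -ltnS ltn_ord.
by rewrite subrr mul0r.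
Qed.

Lemma halfC : 2^-1 = (2^-1 : R)%:C%C :> C.
Proof. by rewrite fmorphV rmorph_nat. Qed.

(** In [(S^x)^2 + (S^y)^2] the squares of the ladder operators cancel, leaving half of
    [S^+ S^- + S^- S^+], which is diagonal with known entries. *)
Lemma Casimir : Sx1 R n *m Sx1 R n + Sy1 R n *m Sy1 R n + Sz1 R n *m Sz1 R n
  = (spinS R n * (spinS R n + 1))%:C%C%:M.
Proof.
have ii : (2 * 'i%C : C)^-1 * (2 * 'i%C)^-1 = - (2^-1 * 2^-1).
  have i2 : 'i%C * 'i%C = -1 :> C by rewrite -expr2 sqr_i.
  by rewrite -!invfM mulrACA i2 mulrN1 invrN.
rewrite /Sx1 /Sy1 -!scalemxAl -!scalemxAr !scalerA ii scaleNr -scalerBr.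
set P := Splus1 R n; set M := Sminus1 R n.
have -> : (P + M) *m (P + M) - (P - M) *m (P - M) = (P *m M + M *m P) *+ 2.
  clearbody P M; rewrite mulmxDl mulmxBl !mulmxDr !mulmxN.
  move: (P *m P) (P *m M) (M *m P) (M *m M) => A B A' B'.
  by apply/matrixP => i j; rewrite !mxE; ring.
rewrite /P /M Splus_Sminus Sminus_Splus; apply/matrixP => i j; rewrite !mxE.
rewrite (bigD1 i) //= big1 ?addr0; last first.
  by move=> l /negPf li; rewrite !mxE eq_sym li mul0r.
rewrite !mxE eqxx; case: eqP => [->|_]; last by rewrite !(mulr0n, mul0r, mulr0, addr0, mul0rn).
rewrite !mulr1n halfC -!rmorphM -!rmorphD -!rmorphM -!rmorphD; congr (_%:C%C); by rewrite /magM /spinS; field.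
Qed.

(** It will show that [S^z] has zero diagonal in an eigenbasis of [S^x]. *)
Lemma commutator_xy : Sx1 R n *m Sy1 R n - Sy1 R n *m Sx1 R n = 'i%C *: Sz1 R n.
Proof.
rewrite /Sx1 /Sy1 -!scalemxAl -!scalemxAr !scalerA [_ * 2^-1]mulrC -scalerBr.
set P := Splus1 R n; set M := Sminus1 R n.
have -> : (P + M) *m (P - M) - (P - M) *m (P + M) = (M *m P - P *m M) *+ 2.
  clearbody P M; rewrite mulmxDl mulmxBl !mulmxDr !mulmxN.
  move: (P *m P) (P *m M) (M *m P) (M *m M) => A B A' B'.
  by apply/matrixP => i j; rewrite !mxE; ring.
have iV : ('i%C : C)^-1 = - 'i%C.
  have i0 : ('i%C : C) != 0 by rewrite eq_complex /= oner_eq0 andbF.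
  by apply: (mulIf i0); rewrite mulVf // mulNr -expr2 sqr_i opprK.
rewrite /P /M Splus_Sminus Sminus_Splus; apply/matrixP => i j; rewrite !mxE.
case: eqP => [->|_]; last by rewrite !(mulr0n, mul0r, mulr0, oppr0, addr0, mul0rn).
have cE : 2^-1 / (2 * 'i%C) = 'i%C * (- (2^-1 * 2^-1) : R)%:C%C :> C.
  by rewrite invfM iV rmorphN rmorphM fmorphV rmorph_nat; ring.
rewrite !mulr1n cE -mulrA; congr (_ * _).
rewrite -!rmorphB -!rmorphD -!rmorphM; congr (_%:C%C); by rewrite /magM /spinS; field.
Qed.

Lemma adj_S1 a : (S1 R n a)^t* = S1 R n a.
Proof.
have adjD (A B : 'M[C]_n.+1) : (A + B)^t* = A^t* + B^t*.
  by apply/matrixP => i j; rewrite !mxE rmorphD.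
have adjZ (c : C) (A : 'M[C]_n.+1) : (c *: A)^t* = c^* *: A^t*.
  by apply/matrixP => i j; rewrite !mxE rmorphM.
have adjN (A : 'M[C]_n.+1) : (- A)^t* = - A^t*.
  by apply/matrixP => i j; rewrite !mxE rmorphN.
case: a => /=.
- rewrite /Sx1 adjZ adjD adj_Splus1 adj_Sminus1 addrC fmorphV.
  by rewrite [X in X^-1]conjC_nat.
- rewrite /Sy1 adjZ adjD adjN adj_Splus1 adj_Sminus1 -opprB scalerN -scaleNr.
  congr (_ *: _); rewrite fmorphV rmorphM /= conjC_nat -invrN -mulrN.
  by congr (_ * _)^-1; apply/eqP; rewrite eq_complex /= oppr0 opprK !eqxx.
- apply/matrixP => i j; rewrite !mxE eq_sym; case: eqP => [->|_]; last exact: conjC0.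
  exact: conjc_real.
Qed.

End SpinAlgebra.

(** * Explicit diagonalization of the operator [S^x] *)

Section SpinDiagonalization.
Variables (R : realType) (n : nat).
Local Notation C := R[i].

(* In the model of spin [n/2] on polynomials of degree at most [n], the operator [2 S^x] is
   [p |-> (1 - X^2) p' + n X p], with eigenvectors [(1+X)^m (1-X)^(n-m)]. *)
Definition eigpoly (m : nat) : {poly R} := (1 + 'X) ^+ m * (1 - 'X) ^+ (n - m).

(** The two factors satisfy [(1 + X) A' = m A] and [(1 - X) B' = - (n - m) B]; the Leibniz rule and
    [1 - X^2 = (1 - X) (1 + X)] combine them. *)
Lemma eigpoly_ode (m : nat) : (m <= n)%N ->
  (1 - 'X ^+ 2) * (eigpoly m)^`() + n%:R * 'X * eigpoly m
  = (m%:R *+ 2 - n%:R) * eigpoly m.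
Proof.
move=> mn.
have dp k : (1 + 'X) * ((1 + 'X : {poly R}) ^+ k)^`() = k%:R * (1 + 'X) ^+ k.
  case: k => [|k]; first by rewrite expr0 derivC mulr0 mul0r.
  rewrite deriv_exp derivD derivC derivX add0r mul1r /= exprS mulrnAr.
  by rewrite mulr_natl.
have dm k : (1 - 'X) * ((1 - 'X : {poly R}) ^+ k)^`() = - k%:R * (1 - 'X) ^+ k.
  case: k => [|k]; first by rewrite expr0 derivC mulr0 oppr0 mul0r.
  rewrite deriv_exp derivB derivC derivX sub0r mulN1r /= exprS mulrnAr.
  by rewrite mulNr mulr_natl mulrN mulNrn.
rewrite /eigpoly derivM.
set A := (1 + 'X) ^+ m; set B := (1 - 'X) ^+ (n - m).
have -> : n%:R = m%:R + (n - m)%:R :> {poly R} by rewrite -natrD subnKC.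
transitivity ((1 - 'X) * B * ((1 + 'X) * A^`()) + (1 + 'X) * A * ((1 - 'X) * B^`())
   + (m%:R + (n - m)%:R) * 'X * (A * B)); first by ring.
by rewrite dp dm -/A -/B; ring.
Qed.

(** Comparing coefficients of [X^k] in the differential equation gives a three-term recurrence, the
    eigenvalue equation of a tridiagonal matrix. *)
Lemma eigpoly_rec (m k : nat) : (m <= n)%N ->
  (k%:R + 1) * (eigpoly m)`_k.+1
    + (if (0 < k)%N then (n%:R - k%:R + 1) * (eigpoly m)`_k.-1 else 0)
  = (m%:R *+ 2 - n%:R) * (eigpoly m)`_k.
Proof.
move=> mn; have /(congr1 (fun q : {poly R} => q`_k)) := eigpoly_ode mn.
rewrite mulrBl mul1r coefD coefB coef_deriv.
rewrite (_ : m%:R *+ 2 - n%:R = (m%:R *+ 2 - n%:R : R)%:P); last first.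
  by rewrite polyCB polyCMn !polyC_natr.
rewrite coefCM => <-; rewrite -polyC_natr -mulrA coefCM coefXnM coefXM coef_deriv.
case: k => [|[|k]] /=.
- by rewrite mulr1n; ring.
- by rewrite mulr2n; ring.
- rewrite subn2 /= -[_`_k.+3 *+ _]mulr_natr -[_`_k.+1 *+ _]mulr_natr.
  by rewrite -[k.+3%:R]natr1 -[k.+2%:R]natr1 -[k.+1%:R]natr1; ring.
Qed.

Lemma eigpoly_coef0 m : (eigpoly m)`_0 = 1.
Proof. by rewrite -horner_coef0 !hornerE expr1n mul1r subr0 expr1n. Qed.

Lemma size_eigpoly m : (m <= n)%N -> (size (eigpoly m) <= n.+1)%N.
Proof.
move=> mn; have sz (c : R) (k : nat) : (size ((1 + c *: 'X : {poly R}) ^+ k)%R <= k.+1)%N.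
  apply: leq_trans (size_poly_exp_leq _ _) _; rewrite ltnS.
  suff : (size (1 + c *: 'X : {poly R})%R <= 2)%N.
    by move=> s2; rewrite -{2}(mul1n k) leq_mul2r -subn1 leq_subLR s2 orbT.
  rewrite (leq_trans (size_polyD _ _)) // geq_max size_poly1 /=.
  by rewrite (leq_trans (size_scale_leq _ _)) // size_polyX.
apply: leq_trans (size_polyMleq _ _) _.
have := sz 1 m; have := sz (-1) (n - m)%N; rewrite scale1r scaleN1r => s1 s2.
have := leq_add s2 s1; rewrite addnS addSn subnKC // => le.
by rewrite -subn1 leq_subLR add1n.
Qed.

(** Coordinates in the basis [sqrt 'C(n, j) X^j], which corresponds to the orthonormal spin basis:
    this rescaling makes the recurrence symmetric. *)
Definition eigcoef (m j : nat) : R := (eigpoly m)`_j / Num.sqrt ('C(n, j)%:R).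

Lemma bin_gt0R j : (j <= n)%N -> 0 < 'C(n, j)%:R :> R.
Proof. by move=> jn; rewrite ltr0n bin_gt0. Qed.

Lemma sqrt_bin_neq0 j : (j <= n)%N -> Num.sqrt 'C(n, j)%:R != 0 :> R.
Proof. by move=> jn; rewrite gt_eqF // sqrtr_gt0 bin_gt0R. Qed.

Lemma bin_rec k : (k < n)%N ->
  (k%:R + 1) * 'C(n, k.+1)%:R = (n%:R - k%:R) * 'C(n, k)%:R :> R.
Proof. by move=> kn; rewrite natr1 -(natrB _ (ltnW kn)) -!natrM mul_bin_left. Qed.

(** The binomial rescaling converts the ladder entries into the coefficients [k + 1] (here) and
    [n - k] (next) of the recurrence. *)
Lemma ladder_bin k : (k < n)%N ->
  ladder R n k / Num.sqrt 'C(n, k.+1)%:R = (k%:R + 1) / Num.sqrt 'C(n, k)%:R.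
Proof.
move=> kn; have k0 : 0 <= k%:R + 1 :> R by rewrite natr1.
apply/eqP; rewrite eqr_div ?sqrt_bin_neq0 ?(ltnW kn) //.
rewrite /ladder -[X in _ == X * _](ger0_norm k0) -sqrtr_sqr -!sqrtrM ?mulr_ge0 ?sqr_ge0 ?subr_ge0 ?ler_nat ?(ltnW kn) //.
by rewrite expr2 -mulrA bin_rec // mulrA [_ * (k%:R + 1)]mulrC.
Qed.

Lemma ladder_bin' k : (k < n)%N ->
  ladder R n k / Num.sqrt 'C(n, k)%:R = (n%:R - k%:R) / Num.sqrt 'C(n, k.+1)%:R.
Proof.
move=> kn; have k0 : 0 <= n%:R - k%:R :> R by rewrite subr_ge0 ler_nat ltnW.
apply/eqP; rewrite eqr_div ?sqrt_bin_neq0 ?(ltnW kn) //.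
rewrite /ladder -[X in _ == X * _](ger0_norm k0) -sqrtr_sqr -!sqrtrM ?mulr_ge0 ?sqr_ge0 ?natr1 //.
by rewrite -natr1 -mulrA bin_rec // mulrA expr2.
Qed.

Definition eigmx : 'M[C]_n.+1 := \matrix_(m, j) (eigcoef m j)%:C%C.

(** Row [m] of [eigmx] is an eigenvector of [S^x]: its equation in column [k] is the recurrence
    divided by [2 sqrt 'C(n, k)]. *)
Lemma eigmx_Sx : eigmx *m Sx1 R n = Sz1 R n *m eigmx.
Proof.
apply/matrixP => m k; rewrite !mxE.
rewrite [RHS](bigD1 m) //= [X in _ = _ + X]big1 ?addr0; last first.
  by move=> l /negPf lm; rewrite !mxE eq_sym lm mul0r.
rewrite !mxE eqxx -rmorphM.
under eq_bigr => j _.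
  rewrite mxE mxE mxE Splus1E Sminus1E !mxE.
  rewrite (_ : _ * _ =
     (if j == k.+1 :> nat then (eigcoef m j * (2^-1 * ladder R n k))%:C%C else 0) +
     (if j.+1 == k :> nat then (eigcoef m j * (2^-1 * ladder R n j))%:C%C else 0)); last first.
    rewrite halfC mulrDr mulrDr [k == _ :> nat]eq_sym.
    by congr (_ + _); case: eqP => _; rewrite ?mulr0 // !rmorphM.
  over.
rewrite big_split /= (sum_ord_if_eq n (fun j => (eigcoef m j * (2^-1 * ladder R n k))%:C%C)).
have mn : (m <= n)%N by rewrite -ltnS.
have -> : \sum_(i < n.+1) (if i.+1 == k :> nat
     then (eigcoef m i * (2^-1 * ladder R n i))%:C%C else 0)
   = (if (0 < k)%N then eigcoef m k.-1 * (2^-1 * ladder R n k.-1) else 0)%:C%C.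
  case: k => [[|k] klt] /=; first by rewrite big1.
  under eq_bigr => i _ do rewrite eqSS.
  rewrite (sum_ord_if_eq n (fun j => (eigcoef m j * (2^-1 * ladder R n j))%:C%C)).
  by rewrite ltnW.
have -> : (if (k.+1 < n.+1)%N then (eigcoef m k.+1 * (2^-1 * ladder R n k))%:C%C else 0)
   = (2^-1 * ((k%:R + 1) * (eigpoly m)`_k.+1 / Num.sqrt 'C(n, k)%:R))%:C%C.
  case: ltnP => kn.
    congr (_%:C%C); rewrite /eigcoef.
    transitivity (2^-1 * (eigpoly m)`_k.+1 * (ladder R n k / Num.sqrt 'C(n, k.+1)%:R)).
      by ring.
    by rewrite ladder_bin //; ring.
  (* At [k = n] the matrix has no further entry, and the coefficient of degree [n + 1] vanishes
     because the degree is at most [n]. *)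
  by rewrite nth_default ?mulr0 ?mul0r ?mulr0 // (leq_trans (size_eigpoly mn)).
rewrite -rmorphD; congr (_%:C%C).
have -> : (if (0 < k)%N then eigcoef m k.-1 * (2^-1 * ladder R n k.-1) else 0)
  = 2^-1 * ((if (0 < k)%N then (n%:R - k%:R + 1) * (eigpoly m)`_k.-1 else 0)
       / Num.sqrt 'C(n, k)%:R).
  case: k => [[|k] klt] /=; first by rewrite mul0r mulr0.
  transitivity (2^-1 * (eigpoly m)`_k * (ladder R n k / Num.sqrt 'C(n, k)%:R)).
    by rewrite /eigcoef; ring.
  by rewrite ladder_bin' // -natr1; ring.
rewrite -mulrDr -mulrDl eigpoly_rec // /eigcoef /magM /spinS; field.
by rewrite sqrt_bin_neq0 // -ltnS.
Qed.

(** Eigenvectors of a Hermitian matrix with distinct eigenvalues are orthogonal, and no row is zero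
    since every constant coefficient is [1]. *)
Lemma eigmx_gram : exists2 g : 'I_n.+1 -> R, forall m, 0 < g m & eigmx *m eigmx^t* = rdiag g.
Proof.
exists (fun m => \sum_j eigcoef m (j : 'I_n.+1) ^+ 2).
  move=> m; rewrite (bigD1 ord0) //= ltr_pwDl ?sumr_ge0 // => [|j _]; last exact: sqr_ge0.
  by rewrite /eigcoef eigpoly_coef0 bin0 sqrtr1 divr1 expr1n.
apply/matrixP => i j; have [->|ij] := eqVneq i j.
  rewrite !mxE eqxx mulr1n rmorph_sum; apply: eq_bigr => l _.
  by rewrite !mxE /= [X in _ * X]conjc_real -rmorphM.
rewrite [RHS]mxE (negPf ij) mulr0n.
(* The Gram matrix commutes with [S^z], whose diagonal entries are distinct, so it is diagonal. *)
have comm : Sz1 R n *m (eigmx *m eigmx^t*) = eigmx *m eigmx^t* *m Sz1 R n.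
  rewrite mulmxA -eigmx_Sx -!mulmxA; congr (_ *m _).
  by rewrite -[X in X *m _](adj_S1 R n ax_x : (Sx1 R n)^t* = _) -adjM eigmx_Sx adjM (adj_S1 R n ax_z : (Sz1 R n)^t* = _).
have /matrixP/(_ i j) := comm.
rewrite mxE (bigD1 i) //= [X in _ + X]big1 ?addr0; last first.
  by move=> l /negPf lm; rewrite [Sz1 _ _ _ _]mxE eq_sym lm mul0r.
rewrite [RHS]mxE [RHS](bigD1 j) //= [X in _ = _ + X]big1 ?addr0; last first.
  by move=> l /negPf lm; rewrite [Sz1 _ _ _ _]mxE lm mulr0.
rewrite ![Sz1 _ _ _ _]mxE !eqxx mulrC => /eqP; rewrite -subr_eq0 -mulrBr mulf_eq0.
case/orP => [/eqP//|]; rewrite -rmorphB -(rmorph0 (real_complex R)).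
rewrite (inj_eq (@complexI R)) /magM opprB addrA subrK subr_eq0 eqr_nat.
by move/eqP/val_inj=> e; rewrite e eqxx in ij.
Qed.

(** Normalizing the rows of [eigmx] gives [v]. The zero diagonal ensures that product eigenstates of
    [S^x] get no energy from the [S^z] bonds. *)
Lemma diagonalize_Sx : exists v : 'M[C]_n.+1, [/\ v \is unitarymx,
  v *m Sx1 R n *m v^t* = Sz1 R n & forall k, (v *m Sz1 R n *m v^t*) k k = 0].
Proof.
have [g g0 gE] := eigmx_gram.
pose e : 'M[C]_n.+1 := rdiag (fun m => (Num.sqrt (g m))^-1).
have eadj : e^t* = e.
  apply/matrixP => i j; rewrite !mxE eq_sym; case: eqP => [->|_].
    by rewrite !mulr1n; exact: conjc_real.
  by rewrite !mulr0n conjC0.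
pose v := e *m eigmx.
have ege : e *m rdiag g *m e = 1%:M.
  rewrite /e /rdiag !mulmx_diag; apply/matrixP => i j; rewrite !mxE.
  by rewrite -!rmorphM mulrAC -invfM -expr2 sqr_sqrtr ?ltW // mulVf ?lt0r_neq0 //.
have vu : v \is unitarymx.
  by apply/unitarymxP; rewrite /v adjM eadj !mulmxA -(mulmxA e) gE.
have eSz : e *m Sz1 R n = Sz1 R n *m e.
  have -> : Sz1 R n = rdiag (@magM R n).
    by apply/matrixP => i j; rewrite !mxE; case: eqP => [->|_].
  by rewrite /e /rdiag diag_mxC.
have vSx : v *m Sx1 R n = Sz1 R n *m v.
  by rewrite /v -mulmxA eigmx_Sx !mulmxA eSz.
have vSxv : v *m Sx1 R n *m v^t* = Sz1 R n by rewrite vSx mulmxtVK.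
clearbody v; exists v; split => // k.
have vSx' : Sx1 R n *m v^t* = v^t* *m Sz1 R n.
  by rewrite -[X in X *m _](adj_S1 R n ax_x : (Sx1 R n)^t* = _) -adjM vSx adjM (adj_S1 R n ax_z : (Sz1 R n)^t* = _).
(* Conjugating [[S^x, S^y] = i S^z] by [v] makes its first factor diagonal, and a commutator with a
   diagonal matrix has zero diagonal. *)
pose Y := v *m Sy1 R n *m v^t*.
have YE : Sz1 R n *m Y - Y *m Sz1 R n = 'i%C *: (v *m Sz1 R n *m v^t*).
  rewrite scalemxAl scalemxAr -commutator_xy mulmxBr mulmxBl; congr (_ - _).
    by rewrite /Y !mulmxA -vSx.
  by rewrite /Y -!mulmxA vSx'.
have /matrixP/(_ k k) := YE; rewrite [RHS]mxE [LHS]mxE [X in _ + X]mxE.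
rewrite [X in X + _]mxE (bigD1 k) //= [X in _ + X - _]big1 ?addr0; last first.
  by move=> l /negPf lm; rewrite [Sz1 _ _ _ _]mxE eq_sym lm mul0r.
rewrite [X in _ - X]mxE (bigD1 k) //= [X in _ - (_ + X)]big1 ?addr0; last first.
  by move=> l /negPf lm; rewrite [Sz1 _ _ _ _]mxE lm mulr0.
rewrite mulrC subrr => /esym/eqP; rewrite mulf_eq0 => /orP[|/eqP //].
by rewrite eq_complex /= oner_eq0 andbF.
Qed.

End SpinDiagonalization.

(** * Product operators and site permutations on the tensor product *)

Section TensorProduct.
Variables (R : realType) (N n : nat).
Local Notation C := R[i].
Implicit Types (F G : site N -> 'M[C]_n.+1) (A B : 'M[C]_n.+1) (r q : site N).

Lemma op_of_kernelM (K L : config N n -> config N n -> C) :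
  op_of_kernel K *m op_of_kernel L = op_of_kernel (fun s t => \sum_u K s u * L u t).
Proof.
apply/matrixP => i j; rewrite !mxE.
rewrite [RHS](reindex _ (onW_bij _ (@enum_val_bij _))).
by apply: eq_bigr => k _; rewrite !mxE.
Qed.

Lemma op_of_kernel1 : op_of_kernel (fun s t : config N n => (s == t)%:R) = 1%:M :> Op R N n.
Proof. by apply/matrixP => i j; rewrite !mxE (inj_eq enum_val_inj). Qed.

Lemma eq_op_of_kernel (K L : config N n -> config N n -> C) :
  (forall s t, K s t = L s t) -> op_of_kernel K = op_of_kernel L.
Proof. by move=> KL; apply/matrixP => i j; rewrite !mxE KL. Qed.

Lemma adj_op_of_kernel (K : config N n -> config N n -> C) :
  (op_of_kernel K)^t* = op_of_kernel (fun s t => (K t s)^*).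
Proof. by apply/matrixP => i j; rewrite !mxE. Qed.

Definition tens F : Op R N n := op_of_kernel (fun s t => \prod_q F q (s q) (t q)).

(** A product over sites of sums over local states expands into a sum over intermediate
    configurations. *)
Lemma tensM F G : tens F *m tens G = tens (fun q => F q *m G q).
Proof.
rewrite /tens op_of_kernelM; apply: eq_op_of_kernel => s t.
under [RHS]eq_bigr => q _ do rewrite mxE.
by rewrite bigA_distr_bigA /=; apply: eq_bigr => u _; rewrite big_split.
Qed.

Lemma eq_tens F G : (forall q, F q = G q) -> tens F = tens G.
Proof.
by move=> FG; apply: eq_op_of_kernel => s t; apply: eq_bigr => q _; rewrite FG.
Qed.

Lemma prod_nat_eq (s t : config N n) (P : pred (site N)) :
  \prod_(q | P q) (s q == t q)%:R = [forall q, P q ==> (s q == t q)]%:R :> C.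
Proof.
case: (boolP [forall q, _]) => [/forallP st|].
  by rewrite big1 // => q Pq; have := st q; rewrite Pq /= => ->.
rewrite negb_forall => /existsP[q]; rewrite negb_imply => /andP[Pq /negPf st].
by rewrite (bigD1 q) //= st mul0r.
Qed.

Lemma tens1 : tens (fun=> 1%:M) = 1%:M.
Proof.
rewrite -op_of_kernel1; apply: eq_op_of_kernel => s t.
under eq_bigr => q _ do rewrite mxE.
rewrite prod_nat_eq; congr (nat_of_bool _)%:R; apply/forallP/eqP => [st|-> q]; last by rewrite eqxx.
by apply/ffunP => q; apply/eqP; exact: st.
Qed.

Lemma adj_tens F : (tens F)^t* = tens (fun q => (F q)^t*).
Proof.
rewrite /tens adj_op_of_kernel; apply: eq_op_of_kernel => s t.
by rewrite rmorph_prod; apply: eq_bigr => q _; rewrite !mxE.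
Qed.

Lemma at_siteE A r : at_site A r = tens (fun q => if q == r then A else 1%:M).
Proof.
apply: eq_op_of_kernel => s t; rewrite (bigD1 r) //= eqxx; congr (_ * _).
under eq_bigr => q qr do rewrite (negPf qr) mxE.
by rewrite prod_nat_eq; case: [forall q, _].
Qed.

Lemma at_siteM A B r : at_site A r *m at_site B r = at_site (A *m B) r.
Proof. by rewrite !at_siteE tensM; apply: eq_tens => q; case: eqP; rewrite ?mulmx1. Qed.

Lemma at_site2E A B r r' : r != r' -> at_site A r *m at_site B r' =
  tens (fun q => if q == r then A else if q == r' then B else 1%:M).
Proof.
move=> rr'; rewrite !at_siteE tensM; apply: eq_tens => q.
by case: eqP => [->|_]; rewrite ?(negPf rr') ?mulmx1 ?mul1mx.
Qed.

Lemma at_site_comm A B r r' : r != r' ->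
  at_site A r *m at_site B r' = at_site B r' *m at_site A r.
Proof.
move=> rr'; rewrite !at_site2E //; last by rewrite eq_sym.
by apply: eq_tens => q; case: eqP => [->|_]; rewrite ?(negPf rr').
Qed.

Lemma at_siteD A B r : at_site (A + B) r = at_site A r + at_site B r.
Proof. by apply/matrixP => i j; rewrite !mxE mulrDl. Qed.

Lemma at_siteZ a A r : at_site (a *: A) r = a *: at_site A r.
Proof. by apply/matrixP => i j; rewrite !mxE mulrA. Qed.

Lemma at_site1 r : at_site 1%:M r = 1%:M :> Op R N n.
Proof. by rewrite at_siteE -tens1; apply: eq_tens => q; case: eqP. Qed.

Lemma at_site_scalar a r : at_site a%:M r = a%:M :> Op R N n.
Proof. by rewrite -scalemx1 at_siteZ at_site1 scalemx1. Qed.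

Lemma adj_at_site A r : (at_site A r)^t* = at_site (A^t*) r.
Proof.
rewrite !at_siteE adj_tens; apply: eq_tens => q; case: eqP => // _.
by rewrite trmx1 map_mx1.
Qed.

Lemma tens_unitary (v : 'M[C]_n.+1) : v \is unitarymx -> tens (fun=> v) \is unitarymx.
Proof.
move=> vu; apply/unitarymxP; rewrite adj_tens tensM -tens1; apply: eq_tens => q.
exact/unitarymxP.
Qed.

Lemma tens_conj_at_site (v A : 'M[C]_n.+1) r : v \is unitarymx ->
  tens (fun=> v) *m at_site A r *m (tens (fun=> v))^t* = at_site (v *m A *m v^t*) r.
Proof.
move=> /unitarymxP vu; rewrite !at_siteE adj_tens !tensM; apply: eq_tens => q.
by case: eqP => // _; rewrite mulmx1.
Qed.

Lemma at_site2_diag A B r r' k : r != r' ->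
  (at_site A r *m at_site B r') k k
  = A (enum_val k r) (enum_val k r) * B (enum_val k r') (enum_val k r').
Proof.
move=> rr'; rewrite at_site2E // mxE (bigD1 r) //= eqxx (bigD1 r') /=; last by rewrite eq_sym.
rewrite eq_sym (negPf rr') eqxx mulrA big1 ?mulr1 // => q /andP[/negPf -> /negPf ->].
by rewrite mxE eqxx.
Qed.

Definition siteperm (p : site N -> site N) : Op R N n :=
  op_of_kernel (fun s t => (t == [ffun q => s (p q)])%:R).

Lemma siteperm_conj p (K : config N n -> config N n -> C) :
  siteperm p *m op_of_kernel K *m (siteperm p)^t*
  = op_of_kernel (fun s t => K [ffun q => s (p q)] [ffun q => t (p q)]).
Proof.
rewrite adj_op_of_kernel !op_of_kernelM; apply: eq_op_of_kernel => s t.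
rewrite (bigD1 [ffun q => t (p q)]) //= eqxx [X in _ + X]big1 ?addr0; last first.
  by move=> u /negPf ->; rewrite conjC0 mulr0.
rewrite conjC1 mulr1 (bigD1 [ffun q => s (p q)]) //= eqxx mul1r big1 ?addr0 //.
by move=> u /negPf ->; rewrite mul0r.
Qed.

Lemma eq_comp_perm (p : site N -> site N) (s t : config N n) : injective p ->
  [ffun q => s (p q)] = [ffun q => t (p q)] -> s = t.
Proof.
move=> pI /ffunP st; have [p' pK p'K] := injF_bij pI.
by apply/ffunP => q; rewrite -(p'K q); have := st (p' q); rewrite !ffunE.
Qed.

Lemma siteperm_unitary p : injective p -> siteperm p \is unitarymx.
Proof.
move=> pI; apply/unitarymxP; have := siteperm_conj p (fun s t => (s == t)%:R).
rewrite op_of_kernel1 mulmx1 => ->; rewrite -op_of_kernel1; apply: eq_op_of_kernel => s t.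
by congr (nat_of_bool _)%:R; apply/eqP/eqP => [/(eq_comp_perm pI)|->].
Qed.

Lemma siteperm_at_site p A r : injective p ->
  siteperm p *m at_site A r *m (siteperm p)^t* = at_site A (p r).
Proof.
move=> pI; rewrite siteperm_conj; apply: eq_op_of_kernel => s t.
have [p' pK p'K] := injF_bij pI.
suff -> : [forall q, (q != r) ==> ([ffun q => s (p q)] q == [ffun q => t (p q)] q)]
  = [forall q, (q != p r) ==> (s q == t q)] by rewrite !ffunE.
apply/forallP/forallP => st q.
  by have := st (p' q); rewrite !ffunE p'K -(inj_eq pI) p'K.
by rewrite !ffunE -(inj_eq pI); exact: st.
Qed.

End TensorProduct.

(** * Parity, symmetries and edge sums on the even torus *)

Section Torus.
Variable M : nat.
Hypothesis oddM : odd M.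
Local Notation N := M.+1.
Implicit Types (b : bool) (r q : site N).

Definition tone : 'I_N := inZp 1.

(** Reduction modulo the even number [N] preserves parity. *)
Lemma odd_addZp (a b : 'I_N) : odd (a + b)%R = odd a (+) odd b.
Proof. by rewrite /= odd_mod ?oddD //= oddM. Qed.

Lemma odd_oppZp (a : 'I_N) : odd (- a)%R = odd a.
Proof.
have Ne : odd N = false by rewrite /= oddM.
have -> : (- a)%R = ((N - a) %% N)%N :> nat by [].
by rewrite odd_mod // oddB ?Ne // ltnW.
Qed.

Lemma odd_tone : odd tone.
Proof. by rewrite /= odd_mod //= oddM. Qed.

(* The neighbour of a coordinate across the bond that starts at parity [b]. *)
Definition part (b : bool) (a : 'I_N) : 'I_N :=
  if odd a == b then a + tone else a - tone.

Lemma odd_part b a : odd (part b a) = ~~ odd a.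
Proof.
by rewrite /part; case: ifP => _; rewrite odd_addZp ?odd_oppZp odd_tone addbT.
Qed.

Lemma partK b : involutive (part b).
Proof.
move=> a; rewrite {1}/part odd_part /part.
by case: (odd a) b => -[] /=; rewrite ?addrK ?subrK.
Qed.

(** A translation for even [c], a reflection for odd [c]. Both preserve the parity at which a bond
    starts, since the reflection also exchanges the two ends of the bond. *)
Definition cmap (c a : 'I_N) : 'I_N := if odd c then c - a else c + a.

Lemma cmap_inj c : injective (cmap c).
Proof. by move=> a a'; rewrite /cmap; case: ifP => _ /addrI // /oppr_inj. Qed.

Lemma cmap_part c b a : cmap c (part b a) = part b (cmap c a).
Proof.
rewrite /cmap /part; case: ifP => oc; rewrite odd_addZp ?odd_oppZp oc; last first.
  by rewrite addFb; case: ifP => _; rewrite addrA.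
by rewrite addTb; case: (odd a) b => -[] /=; rewrite ?opprD ?opprK addrA.
Qed.

Lemma cmap_trans a a' : exists c, cmap c a = a'.
Proof.
(* Points of equal parity are joined by an even translation, points of opposite parity by an odd
   reflection. *)
have [oe|oe] := eqVneq (odd a) (odd a').
  by exists (a' - a); rewrite /cmap odd_addZp odd_oppZp oe addbb subrK.
exists (a' + a); rewrite /cmap odd_addZp addrK.
by move: oe; case: (odd a); case: (odd a').
Qed.

Definition hpart b (r : site N) : site N := (part b r.1, r.2).
Definition vpart b (r : site N) : site N := (r.1, part b r.2).

Lemma hpartK b : involutive (hpart b).
Proof. by case=> r1 r2; rewrite /hpart /= partK. Qed.

Lemma vpartK b : involutive (vpart b).
Proof. by case=> r1 r2; rewrite /vpart /= partK. Qed.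

Lemma hpart_neq b r : r != hpart b r.
Proof.
by apply/eqP => e; have := odd_part b r.1; rewrite -[part _ _]/((hpart b r).1) -e; case: odd.
Qed.

Lemma vpart_neq b r : r != vpart b r.
Proof.
by apply/eqP => e; have := odd_part b r.2; rewrite -[part _ _]/((vpart b r).2) -e; case: odd.
Qed.

Lemma torus_transitive (r r' : site N) : exists p : site N -> site N,
  [/\ injective p, p r = r',
      forall b q, hpart b (p q) = p (hpart b q) &
      forall b q, vpart b (p q) = p (vpart b q)].
Proof.
have [c1 e1] := cmap_trans r.1 r'.1; have [c2 e2] := cmap_trans r.2 r'.2.
exists (fun q => (cmap c1 q.1, cmap c2 q.2)); split.
- by move=> [? ?] [? ?] [] /cmap_inj -> /cmap_inj ->.
- by rewrite e1 e2 -surjective_pairing.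
- by move=> b q; rewrite /hpart /= cmap_part.
- by move=> b q; rewrite /vpart /= cmap_part.
Qed.

Definition edge (b : bool) (r r' : site N) : bool :=
  (hbond r r' && (odd r.1 == b)) || (vbond r r' && (odd r.2 == b)).

Lemma xedgeE (r r' : site N) : xedge r r' = edge false r r'.
Proof. by rewrite /xedge /edge !eqbF_neg. Qed.

Lemma zedgeE (r r' : site N) : zedge r r' = edge true r r'.
Proof. by rewrite /zedge /edge !eqb_id. Qed.

Lemma val_add_tone (a : 'I_N) : (a + tone)%R = (a.+1 %% N)%N :> nat.
Proof.
have -> : (a + tone)%R = ((a + 1 %% N) %% N)%N :> nat by [].
by rewrite modnDmr addn1.
Qed.

Lemma hbondE (r r' : site N) b : odd r.1 == b -> hbond r r' = (r' == hpart b r).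
Proof.
move=> rb; rewrite /hbond /hpart /part rb; case: r' => a a' /=.
by rewrite xpair_eqE -(val_add_tone r.1).
Qed.

Lemma vbondE (r r' : site N) b : odd r.2 == b -> vbond r r' = (r' == vpart b r).
Proof.
move=> rb; rewrite /vbond /vpart /part rb; case: r' => a a' /=.
by rewrite xpair_eqE -(val_add_tone r.2) andbC.
Qed.

Lemma hpart_vpart b r : hpart b r != vpart b r.
Proof.
apply/eqP => -[e _]; have := odd_part b r.1; rewrite e.
by case: (odd _).
Qed.

(** The horizontal and vertical partners are distinct, so the disjunction defining [edge] splits
    into two terms without double counting. *)
Lemma sum_edge_at (V : zmodType) b r (f : site N -> V) :
  \sum_(r' | edge b r r') f r' =
  (if odd r.1 == b then f (hpart b r) else 0) + (if odd r.2 == b then f (vpart b r) else 0).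
Proof.
rewrite big_mkcond /=.
rewrite (eq_bigr (fun r' => (if (r' == hpart b r) && (odd r.1 == b) then f r' else 0)
   + (if (r' == vpart b r) && (odd r.2 == b) then f r' else 0))); last first.
  move=> r' _; rewrite /edge.
  have -> : hbond r r' && (odd r.1 == b) = (r' == hpart b r) && (odd r.1 == b).
    by case: (boolP (odd r.1 == b)) => [rb|_]; rewrite ?andbF // (hbondE _ rb).
  have -> : vbond r r' && (odd r.2 == b) = (r' == vpart b r) && (odd r.2 == b).
    by case: (boolP (odd r.2 == b)) => [rb|_]; rewrite ?andbF // (vbondE _ rb).
  have [->|_] := eqVneq r' (hpart b r); last by rewrite /= add0r.
  by rewrite (negPf (hpart_vpart b r)) /= orbF addr0.
have aux x (c : bool) : \sum_r' (if (r' == x) && c then f r' else 0) = if c then f x else 0.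
  by rewrite (bigD1 x) //= eqxx big1 ?addr0 // => q /negPf ->.
by rewrite big_split /= !aux.
Qed.

(** The involution exchanges [P] with its complement and preserves [f], so both halves have the same
    sum. *)
Lemma sum_involution_half (V : zmodType) (f : site N -> V) (h : site N -> site N)
    (P : pred (site N)) : involutive h -> (forall r, P (h r) = ~~ P r) ->
  (forall r, f (h r) = f r) -> (\sum_r (if P r then f r else 0)) *+ 2 = \sum_r f r.
Proof.
move=> hK Ph fh; rewrite mulr2n {2}(reindex_inj (inv_inj hK)) -big_split /=.
by apply: eq_bigr => r _; rewrite Ph fh; case: (P r); rewrite ?addr0 ?add0r.
Qed.

(** Each site has one horizontal and one vertical partner of type [b]; summing over all sites visits
    every edge from both ends. *)
Lemma sum_edges (V : zmodType) b (F : site N -> site N -> V) :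
  (forall r r', F r r' = F r' r) ->
  (\sum_r \sum_(r' | edge b r r') F r r') *+ 2
  = \sum_r (F r (hpart b r) + F r (vpart b r)).
Proof.
move=> Fsym; under eq_bigr => r _ do rewrite sum_edge_at.
rewrite !big_split /= mulrnDl; congr (_ + _).
  apply: (sum_involution_half (f := fun r => F r (hpart b r)) (P := fun r => odd r.1 == b)
    (@hpartK b)) => r.
    by rewrite odd_part; case: (odd _) b => -[].
  by rewrite hpartK Fsym.
apply: (sum_involution_half (f := fun r => F r (vpart b r)) (P := fun r => odd r.2 == b)
    (@vpartK b)) => r.
  by rewrite odd_part; case: (odd _) b => -[].
by rewrite vpartK Fsym.
Qed.

End Torus.

(** * Correlation inequalities from positivity and the Casimir identity *)

Section Correlations.
Variables (R : realType) (N n : nat).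
Local Notation C := R[i].
Local Notation S := (spinS R n).
Variable B : Op R N n.
Hypothesis Bh : B^t* = B.
Local Notation omega := (gstate B).
Local Notation Sp a r := (@Sop R N n a r).
Local Notation K := (S * (S + 1)).

Lemma adj_Sop a r : (Sp a r)^t* = Sp a r.
Proof. by rewrite /Sop adj_at_site adj_S1. Qed.

Lemma SopC a r r' : Sp a r *m Sp a r' = Sp a r' *m Sp a r.
Proof. by have [->|rr'] := eqVneq r r' => //; rewrite /Sop at_site_comm. Qed.

Lemma omegaB X Y : omega (X - Y) = omega X - omega Y.
Proof. by rewrite gstateD gstateN. Qed.

Lemma omega_sqr_ge0 X : X^t* = X -> 0 <= omega (X *m X).
Proof. by move=> Xh; have := gstate_ge0 X Bh; rewrite Xh. Qed.

(** Expand the positivity of [(X - Y)^2]. *)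
Lemma omega_mul_le X Y : X^t* = X -> Y^t* = Y -> X *m Y = Y *m X ->
  omega (X *m Y) *+ 2 <= omega (X *m X) + omega (Y *m Y).
Proof.
move=> Xh Yh XY; have : 0 <= omega ((X - Y) *m (X - Y)).
  apply: omega_sqr_ge0; rewrite -[in RHS]Xh -[in RHS]Yh.
  by apply/matrixP => i j; rewrite !mxE rmorphB.
rewrite mulmxBl !mulmxBr -XY !omegaB.
move: (omega (X *m X)) (omega (X *m Y)) (omega (Y *m Y)) => x y z.
by rewrite -[in X in _ -> X]subr_ge0 (_ : x - y - (y - z) = x + z - y *+ 2); last by ring.
Qed.

Lemma omega_comm_ge0 X Y : X^t* = X -> Y^t* = Y -> X *m Y = Y *m X ->
  0 <= omega (X *m X *m (Y *m Y)).
Proof.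
move=> Xh Yh XY; have := gstate_ge0 (X *m Y) Bh; rewrite adjM Xh Yh -XY.
by rewrite -!mulmxA [Y *m (X *m Y)]mulmxA -XY !mulmxA.
Qed.

Lemma dimH_gt0 : (0 < dimH N n)%N.
Proof. by apply/card_gt0P; exists [ffun=> ord0]. Qed.

Lemma omega_scalar a : omega a%:M = a.
Proof. by rewrite -scalemx1 gstateZ gstate1 ?mulr1 // dimH_gt0. Qed.

Variables a b c : axis.
Hypothesis casimir : S1 R n a *m S1 R n a + S1 R n b *m S1 R n b + S1 R n c *m S1 R n c
  = K%:C%C%:M.

Lemma Sop_casimir r : Sp a r *m Sp a r + Sp b r *m Sp b r + Sp c r *m Sp c r = K%:C%C%:M.
Proof. by rewrite /Sop !at_siteM -!at_siteD casimir at_site_scalar. Qed.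

(* [(K - A_r) (K - A_r') >= 0] for [A = (S^a)^2], because [K - A] is a sum of squares. *)
Lemma corr_ge r r' :
  K%:C%C ^+ 2 - K%:C%C * (omega (Sp b r *m Sp b r) + omega (Sp c r *m Sp c r)
     + (omega (Sp b r' *m Sp b r') + omega (Sp c r' *m Sp c r')))
  <= omega (Sp a r *m Sp a r *m (Sp a r' *m Sp a r')).
Proof.
pose Q r := Sp b r *m Sp b r + Sp c r *m Sp c r.
have AE q : Sp a q *m Sp a q = K%:C%C%:M - Q q.
  by have := Sop_casimir q; rewrite -addrA => <-; rewrite addrK.
have QQ : 0 <= omega (Q r *m Q r').
  (* At one site the summands of [Q] at different axes need not commute, but the product is the
     square of a Hermitian operator. At distinct sites it is a sum of products of commuting
     squares. *)
  have [<-|rr'] := eqVneq r r'.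
    apply: omega_sqr_ge0; rewrite /Q.
    have adjD (X Y : Op R N n) : (X + Y)^t* = X^t* + Y^t*.
      by apply/matrixP => i j; rewrite !mxE rmorphD.
    by rewrite adjD !adjM !adj_Sop.
  rewrite /Q mulmxDl !mulmxDr !gstateD.
  by do ![apply: addr_ge0]; apply: omega_comm_ge0; rewrite ?adj_Sop //; exact: at_site_comm.
rewrite !AE mulmxBl !mulmxBr mul_scalar_mx mul_mx_scalar mul_scalar_mx.
rewrite !omegaB !gstateZ omega_scalar !gstateD -subr_ge0.
rewrite (_ : _ - _ = omega (Q r *m Q r')) //.
move: (omega (Q r *m Q r')) (omega (Sp b r *m Sp b r)) (omega (Sp c r *m Sp c r))
  (omega (Sp b r' *m Sp b r')) (omega (Sp c r' *m Sp c r')) K%:C%C => x y z y' z' k.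
by rewrite expr2; ring.
Qed.

(** With [A = (S^a)^2], commute one factor so that the left side reads [S^a_r A_r' S^a_r], then
    replace [A_r'] by [K] minus two squares. Each subtracted term is the mean of some [X^t* *m X]
    with [X = S^d_r' S^a_r]. *)
Lemma corr_le r r' :
  omega (Sp a r *m Sp a r *m (Sp a r' *m Sp a r')) <= K%:C%C * omega (Sp a r *m Sp a r).
Proof.
have AE : Sp a r' *m Sp a r' = K%:C%C%:M - Sp b r' *m Sp b r' - Sp c r' *m Sp c r'.
  by rewrite -(Sop_casimir r') addrAC addrK addrK.
have commA : Sp a r *m (Sp a r' *m Sp a r') = Sp a r' *m Sp a r' *m Sp a r.
  by rewrite mulmxA SopC -!mulmxA SopC.
rewrite -mulmxA commA AE !mulmxBl !mulmxBr !omegaB mul_scalar_mx.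
rewrite -scalemxAr gstateZ -subr_ge0.
have sq q d : 0 <= omega (Sp a r *m (Sp d q *m Sp d q *m Sp a r)).
  have := gstate_ge0 (Sp d q *m Sp a r) Bh.
  by rewrite adjM !adj_Sop -!mulmxA.
have subKK (x y z : C) : x - (x - y - z) = y + z by ring.
by rewrite subKK; apply: addr_ge0; exact: sq.
Qed.

End Correlations.

(** * Bond operators: symmetry and diagonal entries in product bases *)

Section EdgeOperators.
Variables (R : realType) (M n : nat).
Hypothesis oddM : odd M.
Local Notation C := R[i].
Local Notation N := M.+1.
Local Notation S := (spinS R n).
Local Notation Sp a r := (@Sop R N n a r).

Definition edgeop (a : axis) (t : bool) : Op R N n :=
  \sum_(r : site N) \sum_(r' | edge t r r') (Sp a r *m Sp a r').

Lemma edgeop2 a t :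
  edgeop a t *+ 2 = \sum_r (Sp a r *m Sp a (hpart t r) + Sp a r *m Sp a (vpart t r)).
Proof. by rewrite /edgeop sum_edges // => r r'; exact: SopC. Qed.

Lemma adj_sum (I : Type) (s : seq I) (P : pred I) (F : I -> Op R N n) :
  (\sum_(i <- s | P i) F i)^t* = \sum_(i <- s | P i) (F i)^t*.
Proof.
apply: (big_morph (fun X : Op R N n => X^t*)) => [X Y|].
  by apply/matrixP => i j; rewrite !mxE rmorphD.
by apply/matrixP => i j; rewrite !mxE rmorph0.
Qed.

Lemma adj_edgeop a t : (edgeop a t)^t* = edgeop a t.
Proof.
rewrite /edgeop adj_sum; apply: eq_bigr => r _; rewrite adj_sum; apply: eq_bigr => r' _.
by rewrite adjM !adj_Sop SopC.
Qed.

(** Twice the operator is a sum over all sites and their partners, and [p] permutes the sites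
    compatibly with the partner maps. *)
Lemma siteperm_edgeop a t (p : site N -> site N) : injective p ->
  (forall q, hpart t (p q) = p (hpart t q)) -> (forall q, vpart t (p q) = p (vpart t q)) ->
  siteperm R n p *m edgeop a t *m (siteperm R n p)^t* = edgeop a t.
Proof.
move=> pI ph pv; set P := siteperm R n p.
have Pu : P \is unitarymx by exact: siteperm_unitary.
have PM X Y : P *m (X *m Y) *m P^t* = (P *m X *m P^t*) *m (P *m Y *m P^t*).
  by rewrite !mulmxA mulmxKtV.
have two : (2 : C) != 0 by rewrite pnatr_eq0.
apply: (scalerI two); rewrite scalemxAl scalemxAr !scaler_nat edgeop2.
rewrite mulmx_sumr mulmx_suml [RHS](reindex_inj pI) /=; apply: eq_bigr => r _.
rewrite mulmxDr mulmxDl !PM /Sop !siteperm_at_site //.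
by rewrite ph pv.
Qed.

(** Partners are distinct sites, so each diagonal entry factors into diagonal entries of one-site
    matrices. *)
Lemma edgeop_diag (v : 'M[C]_n.+1) a t k : v \is unitarymx ->
  (@tens R N n (fun=> v) *m edgeop a t *m (@tens R N n (fun=> v))^t*) k k *+ 2 =
  \sum_r ((v *m S1 R n a *m v^t*) (enum_val k r) (enum_val k r) *
    ((v *m S1 R n a *m v^t*) (enum_val k (hpart t r)) (enum_val k (hpart t r)) +
     (v *m S1 R n a *m v^t*) (enum_val k (vpart t r)) (enum_val k (vpart t r)))).
Proof.
move=> vu; set V := @tens R N n _.
have Vu : V \is unitarymx by exact: tens_unitary.
have VM X Y : V *m (X *m Y) *m V^t* = (V *m X *m V^t*) *m (V *m Y *m V^t*).
  by rewrite !mulmxA mulmxKtV.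
rewrite -mulr_natl.
rewrite -[LHS](_ : (2 *: (V *m edgeop a t *m V^t*)) k k = _); last by rewrite mxE.
rewrite scalemxAl scalemxAr scaler_nat edgeop2 mulmx_sumr mulmx_suml summxE.
apply: eq_bigr => r _; rewrite mulmxDr mulmxDl !VM mxE mulrDr.
by rewrite /Sop !tens_conj_at_site // !at_site2_diag ?hpart_neq ?vpart_neq.
Qed.

End EdgeOperators.

(** The levels [n - i] with [i] at most the integer part [f] of [eta S] have [M = S - i], and there
    are [f + 1 > eta S] of them. *)
Lemma card_top_levels (R : realType) (n : nat) (eta : R) : 0 < eta <= 1 ->
  eta * spinS R n <= #|[pred m : 'I_n.+1 | (1 - eta) * spinS R n <= magM R m]|%:R.
Proof.
move=> /andP[eta0 eta1]; set G := [pred m | _].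
have S0 : 0 <= spinS R n by rewrite /spinS divr_ge0.
have x0 : 0 <= eta * spinS R n by rewrite mulr_ge0 // ltW.
have /andP[fle flt] := truncn_itv x0.
set f := Num.truncn _ in fle flt.
have fn : (f.+1 <= n.+1)%N.
  rewrite ltnS -(ler_nat R) (le_trans fle) // (le_trans (_ : _ <= 1 * spinS R n)) //.
    by rewrite ler_wpM2r.
  by rewrite mul1r /spinS ler_pdivrMr // ler_peMr // ler1n.
apply: (le_trans (ltW flt)); rewrite ler_nat.
pose g (i : 'I_f.+1) := rev_ord (widen_ord fn i).
have gI : injective g by move=> i j /rev_ord_inj /(congr1 val) /= /val_inj.
rewrite -[X in (X <= _)%N](card_ord f.+1) -(card_codom gI).
apply: subset_leq_card; apply/fintype.subsetP => m /codomP[i ->]; rewrite inE /g /magM /=.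
have ilef : (i <= f)%N by rewrite -ltnS.
have ilen : (i <= n)%N by rewrite (leq_trans ilef).
rewrite subSS natrB // /spinS.
have : i%:R <= eta * (n%:R / 2) :> R by rewrite (le_trans _ fle) // ler_nat.
move=> h; lra.
Qed.

Lemma Re_le_pair (R : realType) (x1 x2 y : R[i]) (c1 c2 : R) (m : nat) :
  y <= c1%:C%C * (m%:R * x1) + c2%:C%C * (m%:R * x2) ->
  complex.Re y <= m%:R * (c1 * complex.Re x1 + c2 * complex.Re x2).
Proof.
have -> : m%:R = (m%:R : R)%:C%C :> R[i] by rewrite rmorph_nat.
rewrite lecE => /andP[_]; rewrite ReD !ReM_real => /le_trans; apply.
by rewrite mulrDr ![m%:R * (_ * _)]mulrCA.
Qed.

(** * Comparison of the bounds on the partition function *)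

Section EnergyBound.
Variables (R : realType) (M n : nat).
Hypotheses (oddM : odd M) (n_gt0 : (0 < n)%N).
Local Notation C := R[i].
Local Notation N := M.+1.
Local Notation S := (spinS R n).
Local Notation Sp a r := (@Sop R N n a r).
Variables (a b : axis) (ta tb : bool) (Ja Jb beta : R) (v : 'M[C]_n.+1).
Hypotheses (Ja_gt0 : 0 < Ja) (Jb_gt0 : 0 < Jb) (beta_gt0 : 0 < beta).
Hypotheses (v_unitary : v \is unitarymx) (v_diag : v *m S1 R n a *m v^t* = Sz1 R n).
Hypothesis v_diag0 : forall k, (v *m S1 R n b *m v^t*) k k = 0.

(** This is [- beta H] with axes and edge types left as parameters, so that both orders of the
    couplings are instances. *)
Definition pairop : Op R N n :=
  (beta * (Ja / S ^+ 2))%:C%C *: edgeop R M n a ta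
  + (beta * (Jb / S ^+ 2))%:C%C *: edgeop R M n b tb.
Local Notation B := pairop.
Local Notation omega := (gstate B).

Lemma spinS_gt0 : 0 < S.
Proof. by rewrite /spinS divr_gt0 // ltr0n. Qed.

Lemma adj_pairop : B^t* = B.
Proof.
have adjD (X Y : Op R N n) : (X + Y)^t* = X^t* + Y^t*.
  by apply/matrixP => i j; rewrite !mxE rmorphD.
have adjZ (x : R) (X : Op R N n) : (x%:C%C *: X)^t* = x%:C%C *: X^t*.
  by apply/matrixP => i j; rewrite !mxE rmorphM; congr (_ * _); exact: conjc_real.
by rewrite /B adjD !adjZ !adj_edgeop.
Qed.

Lemma omega_homogeneous d r r' : omega (Sp d r *m Sp d r) = omega (Sp d r' *m Sp d r').
Proof.
have [p [pI pr ph pv]] := torus_transitive oddM r r'.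
have Pu := siteperm_unitary R n pI.
have := gstate_unitary_conj (Sp d r *m Sp d r) Pu adj_pairop.
have -> : siteperm R n p *m B *m (siteperm R n p)^t* = B.
  by rewrite /B mulmxDr mulmxDl -!scalemxAr -!scalemxAl !siteperm_edgeop.
have -> : siteperm R n p *m (Sp d r *m Sp d r) *m (siteperm R n p)^t* = Sp d r' *m Sp d r'.
  by rewrite /Sop !at_siteM siteperm_at_site // pr.
by move=> ->.
Qed.

(** By [2 X X' <= X^2 + X'^2] and homogeneity each bond contributes at most the one-site second
    moment; the doubled edge sum has two terms per site. *)
Lemma omega_edgeop_le d t r :
  omega (edgeop R M n d t) <= (N * N)%:R * omega (Sp d r *m Sp d r).
Proof.
have pair_le q q' : omega (Sp d q *m Sp d q') <= omega (Sp d r *m Sp d r).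
  have := omega_mul_le adj_pairop (adj_Sop R n d q) (adj_Sop R n d q') (SopC R n d q q').
  have := omega_homogeneous d q r; have := omega_homogeneous d q' r.
  move: (omega (Sp d q *m Sp d q)) (omega (Sp d q' *m Sp d q')) => _ _ -> ->.
  move: (omega _) (omega _) => x y.
  by rewrite -mulr2n ler_pMn2r.
rewrite -(ler_pMn2r (n := 2)) //.
have -> : omega (edgeop R M n d t) *+ 2 = omega (edgeop R M n d t *+ 2).
  by rewrite !mulr2n gstateD.
rewrite edgeop2 // gstate_sum.
have -> : (N * N)%:R * omega (Sp d r *m Sp d r) *+ 2
  = \sum_(q : site N) (omega (Sp d r *m Sp d r) *+ 2).
  by rewrite sumr_const card_prod !card_ord -mulrnAr mulr_natl.
by apply: ler_sum => q _; rewrite gstateD mulr2n lerD.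
Qed.

Definition topconfig (eta : R) (k : 'I_(dimH N n)) : bool :=
  [forall r : site N, (1 - eta) * S <= magM R (enum_val k r)].

Lemma card_topconfig eta : 0 < eta <= 1 ->
  (eta * S) ^+ (N * N) <= #|topconfig eta|%:R.
Proof.
move=> eta01; set G := [pred m : 'I_n.+1 | (1 - eta) * S <= magM R m].
have -> : #|topconfig eta| = (#|G| ^ (N * N))%N.
  rewrite -[X in (_ ^ X)%N](_ : #|{: site N}| = _); last by rewrite card_prod !card_ord.
  rewrite -card_ffun_on -!sum1_card.
  rewrite [RHS](reindex _ (onW_bij _ (@enum_val_bij _))) /=; apply: eq_bigl => k.
  by apply/forallP/ffun_onP.
rewrite natrX lerXn2r ?nnegrE ?ler0n ?card_top_levels //.
by case/andP: eta01 => ? _; rewrite mulr_ge0 ?ltW // spinS_gt0.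
Qed.

(** Peierls over the product states with all levels in the top range: the [b]-edges vanish on the
    diagonal, and the [a]-edge sum is at least [N^2 ((1 - eta) S)^2]. *)
Lemma partition_ge eta : 0 < eta <= 1 ->
  (eta * S) ^+ (N * N) * expR ((N * N)%:R * (beta * Ja * (1 - eta) ^+ 2))
  <= complex.Re (\tr (expmx B)).
Proof.
move=> eta01; have [eta0 eta1] := andP eta01.
have S0 := spinS_gt0.
apply: le_trans (ler_wpM2r (expR_ge0 _) (card_topconfig eta01)) _.
apply: (peierls adj_pairop (tens_unitary N v_unitary)) => k /forallP kP.
rewrite /B mulmxDr mulmxDl -!scalemxAr -!scalemxAl.
rewrite [X in complex.Re X]mxE [X in complex.Re (X + _)]mxE [X in complex.Re (_ + X)]mxE.
have -> : (@tens R N n (fun=> v) *m edgeop R M n b tb *m (@tens R N n (fun=> v))^t*) k k = 0.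
  have := edgeop_diag oddM b tb k v_unitary.
  rewrite big1; last by move=> r _; rewrite v_diag0 mul0r.
  by move/eqP; rewrite mulrn_eq0 /= => /eqP.
rewrite mulr0 addr0 ReM_real; set x := complex.Re _.
suff xge : (N * N)%:R * ((1 - eta) * S) ^+ 2 <= x.
  have c0 : 0 <= beta * (Ja / S ^+ 2).
    by rewrite mulr_ge0 ?divr_ge0 ?sqr_ge0 // ltW.
  apply: le_trans (ler_wpM2l c0 xge).
  by rewrite le_eqVlt; apply/orP; left; apply/eqP; field; rewrite lt0r_neq0.
rewrite -(ler_pMn2r (n := 2)) //.
have -> : x *+ 2 = \sum_r (magM R (enum_val k r) *
    (magM R (enum_val k (hpart ta r)) + magM R (enum_val k (vpart ta r)))).
  have := edgeop_diag oddM a ta k v_unitary.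
  move/(congr1 (@complex.Re R)); rewrite !mulr2n ReD => ->.
  rewrite Re_sum; apply: eq_bigr => r _; rewrite v_diag /Sz1 !mxE !eqxx.
  by rewrite -rmorphD -rmorphM.
have -> : (N * N)%:R * ((1 - eta) * S) ^+ 2 *+ 2
  = \sum_(r : site N) ((1 - eta) * S * ((1 - eta) * S + (1 - eta) * S)).
  by rewrite sumr_const card_prod !card_ord -mulr2n mulrnAr -expr2 -mulrnAr mulr_natl.
have m0 : 0 <= (1 - eta) * S by rewrite mulr_ge0 ?subr_ge0 // ltW.
by apply: ler_sum => r _; rewrite ler_pM ?addr_ge0 // lerD.
Qed.

(** Both bounds on the partition function are exponential in [N^2], so taking logarithms per site
    leaves an inequality free of [N]. *)
Lemma energy_bound eta r : 0 < eta <= 1 ->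
  ln (eta / 4) + beta * Ja * (1 - eta) ^+ 2
  <= beta * (Ja / S ^+ 2) * complex.Re (omega (Sp a r *m Sp a r))
   + beta * (Jb / S ^+ 2) * complex.Re (omega (Sp b r *m Sp b r)).
Proof.
move=> eta01; have [eta0 eta1] := andP eta01; have S0 := spinS_gt0.
set rhs := (X in _ <= X).
have NN0 : 0 < (N * N)%:R :> R by rewrite ltr0n.
have le1 : complex.Re (omega B) <= (N * N)%:R * rhs.
  apply: Re_le_pair.
  rewrite {2}/B gstateD !gstateZ lerD // ler_wpM2l ?omega_edgeop_le // ler0c.
    by rewrite mulr_ge0 ?divr_ge0 ?sqr_ge0 // ltW.
  by rewrite mulr_ge0 ?divr_ge0 ?sqr_ge0 // ltW.
have le2 := le_trans (partition_ge eta01) (partition_le_energy (dimH_gt0 N n) adj_pairop).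
have dimE : (dimH N n)%:R = (n.+1%:R ^+ (N * N)) :> R.
  by rewrite /dimH card_ffun card_prod !card_ord natrX.
have lb : expR ((N * N)%:R * (ln (eta / 4) + beta * Ja * (1 - eta) ^+ 2))
    <= expR (complex.Re (omega B)).
  rewrite mulrDr expRD expRM_natl lnK ?posrE ?divr_gt0 //.
  have n0 : 0 < (n.+1%:R : R) ^+ (N * N) by rewrite exprn_gt0.
  rewrite -(ler_pM2l n0) -dimE; apply: le_trans le2.
  rewrite [leLHS]mulrA ler_wpM2r ?expR_ge0 // dimE -exprMn lerXn2r ?nnegrE //.
  - by rewrite mulr_ge0 // divr_ge0 // ltW.
  - by rewrite mulr_ge0 // ltW.
  (* The origin of [eta / 4]: with [S = n / 2], the bound [(eta / 4) (n + 1) <= eta S] amounts to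
     [1 <= n]. *)
  - have : 1 <= n%:R :> R by rewrite ler1n.
    rewrite -natr1 /spinS => n1; nra.
rewrite ler_expR in lb.
by rewrite -(ler_pM2l NN0); exact: le_trans le1.
Qed.

End EnergyBound.

(** * Choice of the constants and the ordering of the spins *)

Lemma small_deficit (R : realType) (Ja Jb eps s l eta alpha x y : R) :
  0 < Jb < Ja -> 0 <= y ->
  Ja * (1 - eta) ^+ 2 - l <= Ja * alpha + Jb * x ->
  alpha + x + y = 1 + s -> Ja * s <= (Ja - Jb) * eps / 3 -> l <= (Ja - Jb) * eps / 3 ->
  Ja * eta = (Ja - Jb) * eps / 6 -> x + y <= eps.
Proof.
move=> /andP[Jb0 JbJa] y0 h1 h2 h3 h4 h5.
have k0 : 0 < Ja - Jb by rewrite subr_gt0.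
(* Eliminating [alpha] gives [(Ja - Jb) x + Ja y <= Ja s + l + 2 Ja eta], where each of the three
   errors is at most a third of [(Ja - Jb) eps]. *)
rewrite -(ler_pM2l k0).
have e2 : 0 <= Ja * eta ^+ 2 by rewrite mulr_ge0 ?sqr_ge0 // ltW // (lt_trans Jb0).
have yJ : 0 <= Jb * y by rewrite mulr_ge0 // ltW.
have h6 : Ja * alpha + Ja * x + Ja * y = Ja + Ja * s by rewrite -!mulrDr h2 mulrDr mulr1.
have h7 : Ja * (1 - eta) ^+ 2 = Ja - 2 * (Ja * eta) + Ja * eta ^+ 2 by ring.
rewrite h7 h5 in h1.
rewrite mulrDr !mulrBl.
lra.
Qed.

Lemma ordered_axis (R : realType) (J1 J2 Ja Jb : R) (a b c : axis) (ta tb : bool) :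
  0 < Jb < Ja ->
  (forall M n (beta : R), - beta%:C%C *: Ham J1 J2 M.+1 n = pairop M n a b ta tb Ja Jb beta) ->
  (forall n, S1 R n a *m S1 R n a + S1 R n b *m S1 R n b + S1 R n c *m S1 R n c
     = (spinS R n * (spinS R n + 1))%:C%C%:M) ->
  (forall n, exists v : 'M[R[i]]_n.+1, [/\ v \is unitarymx,
     v *m S1 R n a *m v^t* = Sz1 R n & forall k, (v *m S1 R n b *m v^t*) k k = 0]) ->
  ordered_claim J1 J2 a c b.
Proof.
move=> JJ HamE casimir diag delta delta0.
have /andP[Jb0 JbJa] := JJ; have Ja0 := lt_trans Jb0 JbJa.
have k0 : 0 < Ja - Jb by rewrite subr_gt0.
(* The bound [eps <= 1] yields [eta <= 1]. As [1 + 1/S <= 2], the upper correlations are at most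
   [2 eps < delta], and the lower one loses at most [4 eps <= 2 delta]. *)
pose eps := Num.min 1 (delta / 3).
have eps0 : 0 < eps by rewrite lt_min ltr01 divr_gt0.
have eps1 : eps <= 1 by rewrite ge_min lexx.
have epsd : eps <= delta / 3 by rewrite ge_min lexx orbT.
have ke0 : 0 < (Ja - Jb) * eps by rewrite mulr_gt0.
pose eta := (Ja - Jb) * eps / (6 * Ja).
have eta01 : 0 < eta <= 1.
  rewrite divr_gt0 ?mulr_gt0 //= ler_pdivrMr ?mulr_gt0 // mul1r.
  have : (Ja - Jb) * eps <= (Ja - Jb) * 1 by rewrite ler_wpM2l // ltW.
  by move=> h; lra.
pose L := - ln (eta / 4).
(* Thresholds: [beta >= x1] controls the entropy error [L / beta], and [S >= x2] the Casimir error
   [Ja / S]. *)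
pose x1 := 3 * `|L| / ((Ja - Jb) * eps); pose x2 := 3 * Ja / ((Ja - Jb) * eps).
have x10 : 0 <= x1 by rewrite divr_ge0 ?mulr_ge0 // ltW.
have x20 : 0 <= x2 by rewrite divr_ge0 ?mulr_ge0 // ltW.
(* With [beta >= 1], the condition [S >= beta^2] gives [S >= beta], so [S] passes the threshold [x2]
   as well. *)
exists 1; split=> //; exists (1 + x1 + x2) => beta betab n n0; rewrite mul1r => Sbeta.
(* All estimates are uniform in [N]; only the empty torus is excluded. *)
exists 1%N => -[//|M] _ /=; rewrite negbK => oddM.
have beta1 : 1 <= beta by apply: le_trans betab; rewrite -addrA lerDl addr_ge0.
have beta0 : 0 < beta by rewrite (lt_le_trans ltr01).
have S0 : 0 < spinS R n by exact: spinS_gt0.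
have Sb : beta <= spinS R n.
  by apply: le_trans Sbeta; rewrite expr2 ler_peMl // ltW.
set S := spinS R n in S0 Sb Sbeta *.
have s1 : S^-1 <= 1 by rewrite invf_le1 // (le_trans beta1).
have s0 : 0 <= S^-1 by rewrite invr_ge0 ltW.
have hs : Ja * S^-1 <= (Ja - Jb) * eps / 3.
  have : x2 <= S by apply: le_trans Sb; apply: le_trans betab; rewrite lerDr addr_ge0.
  by rewrite ler_pdivrMr // => h; rewrite ler_pdivrMr //; lra.
have hl : L / beta <= (Ja - Jb) * eps / 3.
  have : x1 <= beta by apply: le_trans betab; rewrite addrAC lerDr addr_ge0.
  rewrite ler_pdivrMr // => h; rewrite ler_pdivrMr //.
  by have := ler_norm L; lra.
have heta : Ja * eta = (Ja - Jb) * eps / 6.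
  by rewrite /eta; field; rewrite lt0r_neq0.
have [v [vu va vb]] := diag n.
pose B := pairop M n a b ta tb Ja Jb beta.
have Bh : B^t* = B by exact: adj_pairop.
have casb : S1 R n b *m S1 R n b + S1 R n a *m S1 R n a + S1 R n c *m S1 R n c
    = (S * (S + 1))%:C%C%:M by rewrite -casimir [X in X + _]addrC.
have casc : S1 R n c *m S1 R n c + S1 R n a *m S1 R n a + S1 R n b *m S1 R n b
    = (S * (S + 1))%:C%C%:M by rewrite -casimir -addrA addrC.
pose u d r : R := complex.Re (gstate B (@Sop R M.+1 n d r *m Sop R n d r)) / S ^+ 2.
have S20 : 0 < S ^+ 2 by rewrite exprn_gt0.
have uE d r : gstate B (Sop R n d r *m Sop R n d r) = (S ^+ 2 * u d r)%:C%C.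
  rewrite /u mulrC divfK ?lt0r_neq0 // RRe_real // ger0_real //.
  by apply: omega_sqr_ge0 => //; exact: adj_Sop.
have u0 d r : 0 <= u d r.
  have : 0 <= gstate B (@Sop R M.+1 n d r *m Sop R n d r).
    by apply: omega_sqr_ge0 => //; exact: adj_Sop.
  by rewrite uE ler0c pmulr_rge0.
have small r : u b r + u c r <= eps.
  have en := energy_bound oddM n0 ta tb Ja0 Jb0 beta0 vu va vb r eta01.
  have /(congr1 (gstate B)) := Sop_casimir (casimir n) r.
  rewrite omega_scalar // !gstateD !uE -!rmorphD => /complexI sumE.
  apply: (small_deficit (alpha := u a r) JJ (u0 c r) _ _ hs hl heta).
    move: en; rewrite -/B !uE /= => en.
    rewrite -(ler_pM2l beta0).
    have -> : beta * (Ja * (1 - eta) ^+ 2 - L / beta) = ln (eta / 4) + beta * Ja * (1 - eta) ^+ 2.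
      by rewrite /L; field; rewrite lt0r_neq0.
    apply: le_trans en _; rewrite le_eqVlt; apply/orP; left; apply/eqP.
    by rewrite -/S; clearbody S u; field; rewrite lt0r_neq0.
  apply: (mulfI (lt0r_neq0 S20)); rewrite !mulrDr sumE.
  by rewrite -/S; field; rewrite lt0r_neq0.
have upper d d' d'' r r' : S1 R n d *m S1 R n d + S1 R n d' *m S1 R n d' + S1 R n d'' *m S1 R n d''
    = (S * (S + 1))%:C%C%:M -> u d r <= eps -> corr4 J1 J2 beta n d r r' < delta%:C%C.
  move=> cas ud; rewrite /corr4 -/S /gibbs HamE -/B -/(gstate B _).
  have := corr_le Bh cas r r'; rewrite uE => le1.
  have c0 : 0 <= (S ^- 4)%:C%C :> R[i] by rewrite ler0c invr_ge0 exprn_ge0 // ltW.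
  apply: le_lt_trans (ler_wpM2l c0 le1) _.
  rewrite -!rmorphM ltcR.
  have -> : S ^- 4 * (S * (S + 1) * (S ^+ 2 * u d r)) = (1 + S^-1) * u d r.
    by field; rewrite lt0r_neq0.
  have : S^-1 * u d r <= 1 * u d r by rewrite ler_wpM2r.
  by move=> h; rewrite mulrDl; lra.
move=> r r'; split; last split.
- rewrite /corr4 -/S /gibbs HamE -/B -/(gstate B _).
  have := corr_ge Bh (casimir n) r r'; rewrite !uE => le1.
  have c0 : 0 <= (S ^- 4)%:C%C :> R[i] by rewrite ler0c invr_ge0 exprn_ge0 // ltW.
  apply: le_trans (ler_wpM2l c0 le1).
  rewrite -!rmorphD -rmorphXn -!rmorphM -rmorphB -rmorphM lecR.
  have -> : S ^- 4 * ((S * (S + 1)) ^+ 2 - S * (S + 1) *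
     (S ^+ 2 * u b r + S ^+ 2 * u c r + (S ^+ 2 * u b r' + S ^+ 2 * u c r')))
     = (1 + S^-1) ^+ 2 - (1 + S^-1) * (u b r + u c r + (u b r' + u c r')).
    move: (u b r) (u c r) (u b r') (u c r') => x y x' y'.
    by clearbody S u; field; rewrite lt0r_neq0.
  have := small r; have := small r'.
  have := u0 b r; have := u0 c r; have := u0 b r'; have := u0 c r'.
  move: (u b r) (u c r) (u b r') (u c r') => y1 y2 y3 y4 ? ? ? ? ? ?.
  have : S^-1 * (y1 + y2 + (y3 + y4)) <= 1 * (y1 + y2 + (y3 + y4)).
    by rewrite ler_wpM2r // !addr_ge0.
  have : 0 <= S^-1 ^+ 2 by rewrite sqr_ge0.
  by move=> h1 h2; rewrite sqrrD mulrDl; lra.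
- by apply: (upper _ _ _ _ _ casc); apply: le_trans (small r); rewrite lerDr.
- by apply: (upper _ _ _ _ _ casb); apply: le_trans (small r); rewrite lerDl.
Qed.

Theorem theorem2p6 (R : realType) (J1 J2 : R) :
  (0 < J2 < J1 -> ordered_claim J1 J2 ax_x ax_y ax_z) /\
  (0 < J1 < J2 -> ordered_claim J1 J2 ax_z ax_y ax_x).
Proof.
have HamE M n (beta : R) : - beta%:C%C *: Ham J1 J2 M.+1 n
    = (beta * (J1 / spinS R n ^+ 2))%:C%C *: edgeop R M n ax_x false
    + (beta * (J2 / spinS R n ^+ 2))%:C%C *: edgeop R M n ax_z true.
  rewrite /Ham scaleNr scalerBr scalerN opprB opprK addrC !scalerA -!rmorphM /edgeop.
  congr (_ *: _ + _ *: _); apply: eq_bigr => r _; apply: eq_bigl => r'.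
    by rewrite xedgeE.
  by rewrite zedgeE.
split=> JJ.
  apply: (ordered_axis (ta := false) (tb := true) JJ) => //.
    move=> n; rewrite /= addrAC; exact: Casimir.
  exact: diagonalize_Sx.
apply: (ordered_axis (ta := true) (tb := false) JJ) => n.
- by move=> m beta; rewrite HamE /pairop [RHS]addrC.
- rewrite -(Casimir R n) [RHS]addrC [RHS]addrA /=; reflexivity.
(* For the [z] axis the basis is already an eigenbasis, and [S^x] has zero diagonal there because
   the ladder operators change the level. *)
exists 1%:M; rewrite trmx1 map_mx1; split.
- by apply/unitarymxP; rewrite trmx1 map_mx1 mulmx1.
- by rewrite mulmx1 mul1mx.
move=> k; rewrite mulmx1 mul1mx /= /Sx1 Splus1E Sminus1E !mxE.
by rewrite (ltn_eqF (ltnSn k)) addr0 mulr0.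
Qed.
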